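(* Let $U$ be the open unit disk in $\mathbb{C}$ and let $\varphi$ be a linear fractional self-map of $U$. Then the composition operator $C_\varphi$ is hypercyclic on the Hardy space $H^2$ if and only if $C_\varphi$ is weakly hypercyclic on $H^2$.
   Context: $H^2$ is the Hardy space of holomorphic functions $f(z)=\sum_{n\ge 0}\hat f(n)z^n$ on $U$ with $\sum_n|\hat f(n)|^2<\infty$, with its usual Hilbert space norm $\|f\|^2=\sum_{n\ge 0}|\hat f(n)|^2$. A linear fractional self-map of $U$ is a (nonconstant) linear fractional transformation $\varphi(z)=\frac{az+b}{cz+d}$, $ad-bc\ne 0$, with $\varphi(U)\subseteq U$. The composition operator $C_\varphi$ is $C_\varphi(f)=f\circ\varphi$; it is bounded on $H^2$. A bounded operator $T$ on a Banach space $X$ is hypercyclic if there is $x\in X$ whose orbit $\{T^nx:n\ge 0\}$ is norm dense in $X$, and weakly hypercyclic if there is $x\in X$ whose orbit is dense in $X$ for the weak topology. *)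

(* Defs.v *)
From HB Require Import structures.
From mathcomp Require Import all_boot all_order all_algebra.
From mathcomp Require Import complex ring lra.
From mathcomp Require Import all_classical all_reals topology normedtype sequences.

Set Implicit Arguments.
Unset Strict Implicit.
Unset Printing Implicit Defensive.

Import Order.TTheory GRing.Theory Num.Theory.
Import numFieldNormedType.Exports.

Local Open Scope classical_set_scope.
Local Open Scope ring_scope.
Local Open Scope complex_scope.

Local Notation normc := ComplexField.Normc.normc.

Definition hypercyclic (K : numFieldType) (X : normedModType K) (T : X -> X) :=
  exists x : X, dense (range (fun n => iter n T x)).

Definition continuous_functional (K : numFieldType) (X : normedModType K) :=
  {l : {linear X -> K^o} | continuous l}.

(* X with the coarsest topology making every continuous functional continuous. *)
Definition weak (K : numFieldType) (X : normedModType K) : topologicalType :=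
  sup_topology (fun l : continuous_functional X =>
    Topological.on (initial_topology (sval l))).

Definition weakly_hypercyclic (K : numFieldType) (X : normedModType K)
    (T : X -> X) :=
  exists x : X, @dense (weak X) (range (fun n => iter n T x)).

Definition disk (R : realType) := {z : R[i] | `|z| < 1}.

Section hardy.
Context {R : realType}.
Implicit Types (f g : disk R -> R[i]) (a b : nat -> R[i]).

Definition square_summable a := cvgn (series (fun n => normc (a n) ^+ 2)).

(* f(z) = \sum_n a_n z^n on the disk; R[i]^o is the complex line with its
   usual topology. *)
Definition power_series_of f a := forall z : disk R,
  (series (fun n => a n * val z ^+ n) : nat -> R[i]^o) @ \oo -->
    (f z : R[i]^o).

Definition hardy f := exists a, square_summable a /\ power_series_of f a.

Lemma normcE (x : R[i]) : `|x| = (normc x)%:C.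
Proof. by []. Qed.

Lemma normc_ge0 (x : R[i]) : 0 <= normc x.
Proof. by rewrite -lecR -normcE normr_ge0. Qed.

Lemma normc0 : normc (0 : R[i]) = 0.
Proof. by apply: complexI; rewrite -normcE normr0. Qed.

Lemma normcD (x y : R[i]) : normc (x + y) <= normc x + normc y.
Proof. by rewrite -lecR rmorphD /= -!normcE ler_normD. Qed.

Lemma normcX (x : R[i]) n : normc (x ^+ n) = normc x ^+ n.
Proof. by apply: complexI; rewrite rmorphXn /= -!normcE normrX. Qed.

Lemma normc_real (r : R) : 0 <= r -> normc r%:C = r.
Proof. by move=> r0; rewrite /= expr0n /= addr0 sqrtr_sqr ger0_norm. Qed.

Lemma normc_sum (F : nat -> R[i]) m n :
  normc (\sum_(m <= k < n) F k) <= \sum_(m <= k < n) normc (F k).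
Proof.
rewrite -lecR -normcE (le_trans (ler_norm_sum _ _ _))//.
by rewrite rmorph_sum.
Qed.

Lemma square_summableZ a (l : R[i]) :
  square_summable a -> square_summable (fun n => l * a n).
Proof.
move=> ha; have := @is_cvg_seriesZ R _ (normc l ^+ 2) ha.
rewrite /square_summable; under [X in _ -> cvgn (series X)]eq_fun do
  rewrite ComplexField.Normc.normcM exprMn.
exact.
Qed.

(* Termwise form of the triangle inequality, to be optimised in t. *)
Lemma sqr_normcD (t : R) (x y : R[i]) : 0 < t ->
  normc (x + y) ^+ 2 <= (1 + t) * normc x ^+ 2 + (1 + t^-1) * normc y ^+ 2.
Proof.
move=> t0; have nx := normc_ge0 x; have ny := normc_ge0 y.
have H : normc (x + y) ^+ 2 <= (normc x + normc y) ^+ 2.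
  by rewrite ler_sqr ?nnegrE ?addr_ge0 ?normc_ge0// normcD.
apply: le_trans H _.
set u := normc x; set v := normc y.
have -> : (1 + t) * u ^+ 2 + (1 + t^-1) * v ^+ 2 =
          (u + v) ^+ 2 + t * (u - t^-1 * v) ^+ 2.
  by field; rewrite gt_eqF.
by rewrite lerDl mulr_ge0 ?sqr_ge0 ?ltW.
Qed.

Lemma sqrtr_le_add (s x y : R) : 0 < x -> 0 < y ->
  (forall t, 0 < t -> s <= (1 + t) * x + (1 + t^-1) * y) ->
  Num.sqrt s <= Num.sqrt x + Num.sqrt y.
Proof.
rewrite -sqrtr_gt0 => u0; rewrite -sqrtr_gt0 => v0 h.
have x0 : 0 <= x by apply: ltW; rewrite -sqrtr_gt0.
have y0 : 0 <= y by apply: ltW; rewrite -sqrtr_gt0.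
have := h _ (divr_gt0 v0 u0).
have := sqr_sqrtr x0; have := sqr_sqrtr y0.
move: (Num.sqrt x) (Num.sqrt y) u0 v0 => u v u0 v0 <- <-.
have -> : (1 + v / u) * u ^+ 2 + (1 + (v / u)^-1) * v ^+ 2 = (u + v) ^+ 2.
  by field; rewrite !gt_eqF.
move=> H; have uv : 0 <= u + v by rewrite addr_ge0 ?ltW.
by rewrite -[leRHS](ger0_norm uv) -sqrtr_sqr ler_wsqrtr.
Qed.

Lemma square_summable_comb a b t : 0 < t ->
  square_summable a -> square_summable b ->
  cvgn (series (fun n => (1 + t) * normc (a n) ^+ 2 +
                         (1 + t^-1) * normc (b n) ^+ 2)) /\
  limn (series (fun n => (1 + t) * normc (a n) ^+ 2 +
                         (1 + t^-1) * normc (b n) ^+ 2)) =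
  (1 + t) * limn (series (fun n => normc (a n) ^+ 2)) +
  (1 + t^-1) * limn (series (fun n => normc (b n) ^+ 2)).
Proof.
move=> t0 ha hb.
have ca := @is_cvg_seriesZ R _ (1 + t) ha.
have cb := @is_cvg_seriesZ R _ (1 + t^-1) hb.
split; first exact: (@is_cvg_seriesD R _ _ ca cb).
have := @lim_seriesD R _ _ ca cb.
rewrite (@lim_seriesZ R _ (1 + t) ha) (@lim_seriesZ R _ (1 + t^-1) hb).
exact.
Qed.

Lemma square_summableD a b : square_summable a -> square_summable b ->
  square_summable (fun n => a n + b n).
Proof.
move=> ha hb; have [c _] := square_summable_comb ltr01 ha hb.
apply: series_le_cvg c => n; rewrite ?sqr_ge0//.
  by rewrite invr1 addr_ge0// mulr_ge0 ?sqr_ge0// addr_ge0.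
exact: sqr_normcD.
Qed.

Lemma power_series_ofD f g a b : power_series_of f a -> power_series_of g b ->
  power_series_of (f + g) (fun n => a n + b n).
Proof.
move=> fa gb z.
have h := @cvgD _ (R[i]^o) _ _ _ _ _ _ _ (fa z) (gb z).
rewrite (_ : series _ = (series (fun n => a n * val z ^+ n) : nat -> R[i]^o) +
  (series (fun n => b n * val z ^+ n) : nat -> R[i]^o)); first exact: h.
apply/funext => n; rewrite /series /= -[RHS]big_split; apply: eq_bigr => k _.
by rewrite mulrDl.
Qed.

Lemma power_series_ofZ f a (l : R[i]) : power_series_of f a ->
  power_series_of (l *: f) (fun n => l * a n).
Proof.
move=> fa z.
have h := @cvgZl_tmp _ (R[i]^o) _ _ _ l _ _ (fa z).
rewrite (_ : series _ =
    l \*: (series (fun n => a n * val z ^+ n) : nat -> R[i]^o)); first exact: h.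
apply/funext => n; rewrite /series /= [RHS]mulr_sumr; apply: eq_bigr => k _.
by rewrite mulrA.
Qed.

Lemma square_summable0 : square_summable (fun=> 0).
Proof.
rewrite /square_summable (_ : series _ = fun=> 0); first exact: is_cvg_cst.
apply/funext => n; rewrite /series /= big1// => k _.
by rewrite expr0n addr0 sqrtr0 expr0n.
Qed.

Lemma power_series_of0 : power_series_of 0 (fun=> 0).
Proof.
move=> z; rewrite (_ : series _ = fun=> 0); first exact: cvg_cst.
by apply/funext => n; rewrite /series /= big1// => k _; rewrite mul0r.
Qed.

Lemma square_summable_bounded a : square_summable a ->
  exists2 M : R, 0 < M & forall n, normc (a n) <= M.
Proof.
move=> c.
have nd : nondecreasing_seq (series (fun n => normc (a n) ^+ 2)).
  by apply: nondecreasing_series => k _ _; rewrite sqr_ge0.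
set L := limn (series (fun n => normc (a n) ^+ 2)).
have aL n : normc (a n) ^+ 2 <= L.
  apply: le_trans (nondecreasing_cvgn_le nd c n.+1).
  by rewrite /series /= big_nat_recr//= lerDr sumr_ge0// => k _; rewrite sqr_ge0.
have L0 : 0 <= L by apply: le_trans (sqr_ge0 _) (aL 0%N).
exists (L + 1); first by rewrite ltr_wpDl.
move=> n; have := aL n; have := normc_ge0 (a n); nra.
Qed.

Lemma geometric_tail (r : R) n N : 0 <= r -> r <= 2^-1 -> (n <= N)%N ->
  \sum_(n <= k < N) r ^+ k <= 2 * r ^+ n - 2 * r ^+ N.
Proof.
move=> r0 r1; elim: N => [|N IH].
  by rewrite leqn0 => /eqP ->; rewrite big_geq// subrr.
rewrite leq_eqVlt => /predU1P[->|]; first by rewrite big_geq// subrr.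
rewrite ltnS => nN; rewrite big_nat_recr//= exprS.
have := IH nN; have : 0 <= r ^+ N by rewrite exprn_ge0.
nra.
Qed.

Lemma power_series_unique0 a : square_summable a ->
  power_series_of 0 a -> forall n, a n = 0.
Proof.
move=> /square_summable_bounded[M M0 aM] a0; elim/ltn_ind => n IH.
apply: ComplexField.Normc.eq0_normc; apply/eqP; rewrite eq_le normc_ge0 andbT.
rewrite leNgt; apply/negP => an0.
pose r := normc (a n) / (6 * M).
have M6 : 0 < 6 * M by rewrite mulr_gt0.
have r0 : 0 < r by rewrite divr_gt0.
have r2 : r <= 2^-1.
  by rewrite ler_pdivrMr//; have := aM n; lra.
have z1 : `|r%:C| < 1 :> R[i].
  by rewrite normcE ltcR (normc_real (ltW r0)); apply: le_lt_trans r2 _; lra.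
have e0 : 0 < (M * r ^+ n.+1)%:C :> R[i].
  by rewrite ltcR mulr_gt0 ?exprn_gt0.
have /cvgrPdist_le/(_ _ e0) := a0 (exist (fun z : R[i] => `|z| < 1) _ z1).
case=> N0 _ /(_ (maxn N0 n.+1)) /= /(_ (leq_maxl _ _)).
set N := maxn _ _; have nN : (n < N)%N by rewrite leq_max leqnn orbT.
rewrite /series /= distrC subr0 (big_cat_nat (n := n))//=; last exact: ltnW.
rewrite big_nat_cond big1 ?add0r; last first.
  by move=> k /andP[/andP[_ kn] _]; rewrite IH// mul0r.
rewrite big_ltn// normcE lecR => hS.
set S := \sum_(n.+1 <= _ < N) _ in hS.
have SM : normc S <= M * (2 * r ^+ n.+1).
  apply: le_trans (normc_sum _ _ _) _.
  have G := @geometric_tail r n.+1 N (ltW r0) r2 nN.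
  have rN : 0 <= r ^+ N by rewrite exprn_ge0 ?ltW.
  apply: le_trans (_ : _ <= M * \sum_(n.+1 <= k < N) r ^+ k) _.
    rewrite mulr_sumr; apply: ler_sum => k _.
    rewrite ComplexField.Normc.normcM normcX (normc_real (ltW r0)).
    by rewrite ler_wpM2r ?exprn_ge0 ?(ltW r0).
  by rewrite ler_wpM2l ?(ltW M0)//; lra.
have : normc (a n * r%:C ^+ n) <= M * r ^+ n.+1 + M * (2 * r ^+ n.+1).
  rewrite -[X in normc X](addrK S); apply: le_trans (normcD _ _) _.
  apply: lerD => //.
  by have -> : normc (- S) = normc S by apply: complexI; rewrite -!normcE normrN.
rewrite ComplexField.Normc.normcM normcX (normc_real (ltW r0)) !exprS.
rewrite -mulrDr (_ : r * r ^+ n + _ = 3 * r * r ^+ n); last by ring.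
rewrite mulrA ler_pM2r ?exprn_gt0// /r => H.
have E : M * (3 * (normc (a n) / (6 * M))) = normc (a n) / 2.
  by field; rewrite gt_eqF.
by move: H; rewrite E; lra.
Qed.

Lemma power_series_unique f a b : square_summable a -> square_summable b ->
  power_series_of f a -> power_series_of f b -> a = b.
Proof.
move=> ha hb fa fb; apply/funext => n.
have hc := square_summableD ha (square_summableZ (l := -1) hb).
have := power_series_ofD fa (power_series_ofZ (l := -1) fb).
rewrite scaleN1r subrr => /(power_series_unique0 hc)/(_ n)/eqP.
by rewrite mulN1r subr_eq0 => /eqP.
Qed.

Definition hardyb : {pred (disk R -> R[i])} := fun f => `[< hardy f >].

Lemma hardy_submod_closed : submod_closed hardyb.
Proof.
split.
  apply/asboolP; exists (fun=> 0); split; first exact: square_summable0.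
  exact: power_series_of0.
move=> l f g /asboolP[a [ha fa]] /asboolP[b [hb gb]]; apply/asboolP.
exists (fun n => l * a n + b n); split.
  exact/square_summableD/hb/square_summableZ.
exact/power_series_ofD/gb/power_series_ofZ.
Qed.

HB.instance Definition _ :=
  GRing.isSubmodClosed.Build R[i] (disk R -> R[i]) hardyb hardy_submod_closed.

End hardy.

Record H2 (R : realType) := MkH2 {
  H2_fun :> disk R -> R[i] ;
  H2_subproof : H2_fun \in hardyb }.

HB.instance Definition _ (R : realType) := [isSub for @H2_fun R].
HB.instance Definition _ (R : realType) := [Choice of H2 R by <:].
HB.instance Definition _ (R : realType) := [SubChoice_isSubLmodule of H2 R by <:].

Section hardy_norm.
Context {R : realType}.
Implicit Types (f g : H2 R).

Lemma H2P f : hardy f.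
Proof. exact/asboolP/(H2_subproof f). Qed.

(* The Taylor coefficients of f, unique by power_series_unique. *)
Definition coef f : nat -> R[i] := sval (cid (H2P f)).

Lemma coef_square_summable f : square_summable (coef f).
Proof. by have [] := svalP (cid (H2P f)). Qed.

Lemma coef_power_series f : power_series_of f (coef f).
Proof. by have [] := svalP (cid (H2P f)). Qed.

Arguments coef_square_summable : clear implicits.
Arguments coef_power_series : clear implicits.

Lemma coefP f a : square_summable a -> power_series_of f a -> coef f = a.
Proof.
move=> ha fa; apply: power_series_unique fa => //.
- exact: coef_square_summable.
- exact: coef_power_series.
Qed.

Lemma coefD f g n : coef (f + g) n = coef f n + coef g n.
Proof.
have := coef_square_summable; have := coef_power_series => fa ha.
have -> // := @coefP (f + g) (fun n => coef f n + coef g n).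
  exact: square_summableD.
exact: (power_series_ofD (fa f) (fa g)).
Qed.

Lemma coefZ (l : R[i]) f n : coef (l *: f) n = l * coef f n.
Proof.
have := coef_square_summable; have := coef_power_series => fa ha.
have -> // := @coefP (l *: f) (fun n => l * coef f n).
  exact: square_summableZ.
exact: (power_series_ofZ (l := l) (fa f)).
Qed.

Lemma coef_inj f g : coef f = coef g -> f = g.
Proof.
move=> fg; apply/val_inj/funext => z /=.
have hf := @coef_power_series f z; have := @coef_power_series g z.
rewrite -fg => hg; exact: (@cvg_unique _ (@norm_hausdorff _ (R[i]^o)) _ _ _ _ hf hg).
Qed.

Definition sqr_norm f : R := limn (series (fun n => normc (coef f n) ^+ 2)).

(* The norm of a normed module over R[i] takes its values in R[i]. *)
Definition H2_norm f : R[i] := (Num.sqrt (sqr_norm f))%:C.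

Lemma coef_le_sqr_norm f n : normc (coef f n) ^+ 2 <= sqr_norm f.
Proof.
have c := coef_square_summable f.
have nd : nondecreasing_seq (series (fun n => normc (coef f n) ^+ 2)).
  by apply: nondecreasing_series => k _ _; rewrite sqr_ge0.
apply: le_trans (nondecreasing_cvgn_le nd c n.+1).
rewrite /series /= big_nat_recr//= lerDr sumr_ge0// => k _; exact: sqr_ge0.
Qed.

Lemma sqr_norm_ge0 f : 0 <= sqr_norm f.
Proof. exact: le_trans (sqr_ge0 _) (coef_le_sqr_norm f 0). Qed.

Lemma sqr_norm_eq0 f : sqr_norm f = 0 -> f = 0.
Proof.
move=> f0; have coef0 h : sqr_norm h = 0 -> coef h = fun=> 0.
  move=> h0; apply/funext => n; apply: ComplexField.Normc.eq0_normc.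
  have := coef_le_sqr_norm h n; rewrite h0 => le0.
  by apply/eqP; rewrite -sqrf_eq0 eq_le le0 sqr_ge0.
apply: coef_inj; rewrite coef0//; apply/esym/coefP.
- exact: square_summable0.
- exact: power_series_of0.
Qed.

Lemma sqr_normD t f g : 0 < t ->
  sqr_norm (f + g) <= (1 + t) * sqr_norm f + (1 + t^-1) * sqr_norm g.
Proof.
move=> t0.
have [c <-] := square_summable_comb t0 (coef_square_summable f)
  (coef_square_summable g).
apply: lim_series_le => //; first exact: coef_square_summable.
by move=> n; rewrite coefD; exact: sqr_normcD.
Qed.

Lemma H2_normD f g : H2_norm (f + g) <= H2_norm f + H2_norm g.
Proof.
rewrite /H2_norm -rmorphD lecR.
have [/sqr_norm_eq0 ->|f0] := eqVneq (sqr_norm f) 0.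
  by rewrite add0r lerDr sqrtr_ge0.
have [/sqr_norm_eq0 ->|g0] := eqVneq (sqr_norm g) 0.
  by rewrite addr0 lerDl sqrtr_ge0.
have {}f0 : 0 < sqr_norm f by rewrite lt_neqAle eq_sym f0 sqr_norm_ge0.
have {}g0 : 0 < sqr_norm g by rewrite lt_neqAle eq_sym g0 sqr_norm_ge0.
by apply: sqrtr_le_add f0 g0 _ => t; exact: sqr_normD.
Qed.

Lemma H2_normZ (l : R[i]) f : H2_norm (l *: f) = `|l| * H2_norm f.
Proof.
have -> : H2_norm (l *: f) =
    (Num.sqrt (normc l ^+ 2 * sqr_norm f))%:C.
  congr (Num.sqrt _)%:C; rewrite /sqr_norm.
  rewrite -[RHS](@lim_seriesZ R _ (normc l ^+ 2)
    (coef_square_summable f)).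
  congr (limn (series _)); apply/funext => n.
  by rewrite coefZ ComplexField.Normc.normcM exprMn.
rewrite sqrtrM ?sqr_ge0// sqrtr_sqr ger0_norm ?normc_ge0//.
by rewrite rmorphM normcE.
Qed.

Lemma H2_norm_eq0 f : H2_norm f = 0 -> f = 0.
Proof.
move=> /complexI/eqP; rewrite sqrtr_eq0 => f0.
by apply/sqr_norm_eq0/eqP; rewrite eq_le f0 sqr_norm_ge0.
Qed.

End hardy_norm.

HB.instance Definition _ (R : realType) :=
  Lmodule_isNormed.Build R[i] (H2 R) H2_normD H2_normZ H2_norm_eq0.

Lemma H2_normE (R : realType) (f : H2 R) :
  `|f| = (Num.sqrt (limn (series (fun n => normc (coef f n) ^+ 2))))%:C.
Proof. by []. Qed.

Section composition.
Context {R : realType}.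

(* The self-map is valued in the disk, so a pole in the disk is excluded:
   the condition on the denominator spells this out, since x / 0 = 0. *)
Definition linear_fractional (phi : disk R -> disk R) :=
  exists a b c d : R[i], a * d - b * c != 0 /\
    forall z : disk R, c * val z + d != 0 /\
      val (phi z) = (a * val z + b) / (c * val z + d).

(* The element of H2 equal to f \o phi. It exists for every holomorphic phi by
   Littlewood's subordination principle, and is unique, so that the default
   value 0 is never used. *)
Definition composition_operator (phi : disk R -> disk R) (f : H2 R) : H2 R :=
  xget 0 [set g : H2 R | forall z, g z = f (phi z)].

End composition.

(* Main.v *)
From HB Require Import structures.
From mathcomp Require Import all_boot all_order all_algebra.
From mathcomp Require Import complex ring lra.
From mathcomp Require Import all_classical all_reals topology normedtype sequences realfun.
Require Import Defs.

(** Norm open sets include the weakly open ones, so hypercyclicity implies weak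
    hypercyclicity. The converse follows from a dichotomy: for every linear
    fractional self-map [phi] of the disk, [C_phi] is hypercyclic or it is not
    even weakly hypercyclic ([composition_dichotomy]).

    A fixed point of [phi] in the closed disk always exists
    ([fixed_point_in_closed_disk]). If it lies in the open disk, every orbit is
    constant there, and a point evaluation prevents weak density
    ([fixed_point_not_weakly_hypercyclic]). If it is a point [al] of the unit
    circle, the Cayley transform that sends [al] to infinity turns [phi] into a
    map [w -> A w + B] of the right half-plane, with [A > 0] and [0 <= Re B]
    ([boundary_fixed_point_affine]), whose iterates are explicit.

    If [A = 1] and [0 < Re B], two orbits [phi^n z] and [phi^n w] approach [al]
    non-tangentially at distance [O(n^-2)], while [1 - |phi^n z|] is of order
    [1 / n]. As the derivative of [f] is [O((1 - |z|)^-2)], the differences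
    [f (phi^n z) - f (phi^n w)] are bounded, and the functional
    [f z - f w] is bounded on every orbit ([parabolic_nonautomorphism]).

    In the remaining cases without fixed point in the disk, the criterion of
    Kitai, Gethner and Shapiro applies ([hypercyclicity_criterion],
    [hypercyclic_of_boundary_limits]). Forward, it uses the functions
    [z^k (z - al')] that vanish at the boundary limit [al'] of [phi^n 0];
    backward, the functions [psi^k (psi - be)], where [psi] is chosen so that
    [psi o phi^-n] is again a self-map of the disk, which tends to [be] at the
    origin. Both families span dense subspaces: the first by averaging
    ([approximable_boundary_zero]), the second because [C_psi] has dense range
    ([translation_dense_range]).

    All norm estimates come from one computation with coefficients. If
    [|a z + b| <= |c z + d|] on the circle, then the norm of [(a z + b) h] is at
    most that of [(c z + d) h] ([sqr_norm_affine_mul_le]), so that multiplication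
    by a linear fractional self-map is a contraction
    ([contractive_multiplier]). This gives the boundedness of [C_phi] by
    Littlewood's argument ([comp_poly]) and, since the constant term of
    [chi - al'] is explicit, the decay of [chi^k (chi - al')] when [chi 0] tends
    to [al'] ([nrm_composition_boundary_zero]). *)

Set Implicit Arguments.
Unset Strict Implicit.
Unset Printing Implicit Defensive.

Import Order.TTheory GRing.Theory Num.Theory.
Import numFieldNormedType.Exports.

Local Open Scope classical_set_scope.
Local Open Scope ring_scope.
Local Open Scope complex_scope.

Local Notation normc := ComplexField.Normc.normc.
Local Notation Re := complex.Re.
Local Notation Im := complex.Im.

(** * Complex moduli and limits *)

Section modulus.
Context {R : realType}.
Implicit Types (x y : R[i]).

Lemma normcM x y : normc (x * y) = normc x * normc y.
Proof. exact: ComplexField.Normc.normcM. Qed.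

Lemma normcN x : normc (- x) = normc x.
Proof. by apply: complexI; rewrite -!normcE normrN. Qed.

Lemma normcBC x y : normc (x - y) = normc (y - x).
Proof. by rewrite -normcN opprB. Qed.

Lemma normcV x : normc x^-1 = (normc x)^-1.
Proof. by apply: complexI; rewrite fmorphV -!normcE normfV. Qed.

Lemma normc1 : normc (1 : R[i]) = 1.
Proof. by rewrite (normc_real ler01). Qed.

Lemma normc_eq0 x : (normc x == 0) = (x == 0).
Proof.
apply/eqP/eqP => [/ComplexField.Normc.eq0_normc//|->]; exact: normc0.
Qed.

Lemma normc_gt0 x : (0 < normc x) = (x != 0).
Proof. by rewrite lt_neqAle normc_ge0 andbT eq_sym normc_eq0. Qed.

Lemma normcB_ge x y : normc x - normc y <= normc (x - y).
Proof. by rewrite lerBlDr -{1}(subrK y x); exact: normcD. Qed.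

Lemma sqr_normcE x : normc x ^+ 2 = Re x ^+ 2 + Im x ^+ 2.
Proof. by case: x => u v /=; rewrite sqr_sqrtr// addr_ge0 ?sqr_ge0. Qed.

Lemma normc_Re x : `|Re x| <= normc x.
Proof.
rewrite -ler_sqr ?nnegrE ?normc_ge0// sqr_normcE real_normK ?num_real//.
by rewrite lerDl sqr_ge0.
Qed.

Lemma normc_Im x : `|Im x| <= normc x.
Proof.
rewrite -ler_sqr ?nnegrE ?normc_ge0// sqr_normcE real_normK ?num_real//.
by rewrite lerDr sqr_ge0.
Qed.

Lemma normc_le_ReIm x : normc x <= `|Re x| + `|Im x|.
Proof.
rewrite -ler_sqr ?nnegrE ?normc_ge0 ?addr_ge0// sqr_normcE sqrrD.
rewrite !real_normK ?num_real// addrAC lerDl mulrn_wge0// mulr_ge0//.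
Qed.

Definition pt (z : disk R) : R[i] := val z.

Lemma pt_inj : injective pt.
Proof. exact: val_inj. Qed.

Lemma disk_normc (z : disk R) : normc (pt z) < 1.
Proof. by have := valP z; rewrite normcE ltcR. Qed.

Lemma normc_disk (x : R[i]) : normc x < 1 -> `|x| < 1.
Proof. by rewrite normcE ltcR. Qed.

Definition in_disk (x : R[i]) (hx : normc x < 1) : disk R :=
  exist (fun z : R[i] => `|z| < 1) x (normc_disk hx).

Lemma pt_in_disk (x : R[i]) (hx : normc x < 1) : pt (in_disk hx) = x.
Proof. by []. Qed.

Lemma linear_fractionalP (phi : disk R -> disk R) : linear_fractional phi ->
  exists a b c d : R[i], [/\ a * d - b * c != 0,
    forall z, c * pt z + d != 0 &
    forall z, pt (phi z) = (a * pt z + b) / (c * pt z + d)].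
Proof.
intros [a [b [c [d [det hphi]]]]]; exists a, b, c, d; split.
- exact: det.
- by intros z; destruct (hphi z).
- by intros z; destruct (hphi z).
Qed.

Lemma linear_fractional_intro (phi : disk R -> disk R) (a b c d : R[i]) :
  a * d - b * c != 0 -> (forall z, c * pt z + d != 0) ->
  (forall z, pt (phi z) = (a * pt z + b) / (c * pt z + d)) ->
  linear_fractional phi.
Proof.
intros det np e; exists a, b, c, d; split; first exact: det.
by intros z; split; [exact: (np z)|exact: (e z)].
Qed.

(** The norm of the normed module [R[i]^o] is complex-valued; this moves
    convergence to the real line. *)
Lemma cvgCP (u : nat -> R[i]) (l : R[i]) :
  ((u : nat -> R[i]^o) @ \oo --> (l : R[i]^o)) <->
  ((fun n => normc (u n - l)) @ \oo --> (0 : R)).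
Proof.
split=> [/cvgrPdist_le h|/cvgrPdist_le h]; apply/cvgrPdist_le => e e0.
  have e0' : 0 < e%:C :> R[i] by rewrite ltcR.
  near=> n; have : `|l - u n| <= e%:C by near: n; exact: h.
  by rewrite normcE lecR sub0r normrN ger0_norm ?normc_ge0// normcBC.
have [e1 e2] : e = (Re e)%:C /\ 0 < Re e.
  by move: e0; case: e => a b; rewrite ltcE /= => /andP[/eqP -> ?].
near=> n; rewrite e1 normcE lecR.
have : `|0 - normc (u n - l)| <= Re e by near: n; exact: h.
by rewrite sub0r normrN ger0_norm ?normc_ge0// normcBC.
Unshelve. all: by end_near. Qed.

Lemma cvgC_unique (u : nat -> R[i]) (l m : R[i]) :
  (u : nat -> R[i]^o) @ \oo --> (l : R[i]^o) ->
  (u : nat -> R[i]^o) @ \oo --> (m : R[i]^o) -> l = m.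
Proof. by move=> hl hm; exact: (@cvg_unique _ (@norm_hausdorff _ (R[i]^o)) _ _ _ _ hl hm). Qed.

(** Completeness of the complex line, inherited from the real and imaginary
    parts. *)
Lemma complex_normed_cvg (u : nat -> R[i]) :
  cvgn (series (fun n => normc (u n))) ->
  exists l, (series u : nat -> R[i]^o) @ \oo --> (l : R[i]^o).
Proof.
move=> cu.
have cRe : cvgn (series (fun n => Re (u n))).
  apply: normed_cvg; apply: (series_le_cvg _ _ _ cu) => n /=.
  - exact: normr_ge0.
  - exact: normc_ge0.
  - exact: normc_Re.
have cIm : cvgn (series (fun n => Im (u n))).
  apply: normed_cvg; apply: (series_le_cvg _ _ _ cu) => n /=.
  - exact: normr_ge0.
  - exact: normc_ge0.
  - exact: normc_Im.
move/cvg_ex : cRe => [/= a ha]; move/cvg_ex : cIm => [/= b hb].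
exists (a +i* b); apply/cvgCP.
have hRe n : Re (series u n) = series (fun n => Re (u n)) n.
  by rewrite /series /= raddf_sum.
have hIm n : Im (series u n) = series (fun n => Im (u n)) n.
  by rewrite /series /= raddf_sum.
apply: (@squeeze_cvgr _ _ _ _ (fun=> 0)
  (fun n => `|series (fun n => Re (u n)) n - a| + `|series (fun n => Im (u n)) n - b|)).
- near=> n; rewrite normc_ge0 /= (le_trans (normc_le_ReIm _))//.
  by rewrite -hRe -hIm; case: (series u n).
- exact: cvg_cst.
- rewrite -[X in _ --> X](addr0 0); apply: cvgD.
    by apply/norm_cvg0P; apply/subr_cvg0.
  by apply/norm_cvg0P; apply/subr_cvg0.
Unshelve. all: by end_near. Qed.

End modulus.

(** * The Hardy space as a complete sequence space *)

Arguments coef_square_summable {R} f.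
Arguments coef_power_series {R} f z.

Section hardy_space.
Context {R : realType}.
Implicit Types (f g h : H2 R) (a b : nat -> R[i]).

Definition nrm f : R := Num.sqrt (sqr_norm f).

Lemma nrmE f : `|f| = (nrm f)%:C. Proof. by []. Qed.

Lemma nrm_ge0 f : 0 <= nrm f. Proof. exact: sqrtr_ge0. Qed.

Lemma sqr_nrm f : nrm f ^+ 2 = sqr_norm f.
Proof. by rewrite sqr_sqrtr ?sqr_norm_ge0. Qed.

Lemma nrmD f g : nrm (f + g) <= nrm f + nrm g.
Proof. by have := H2_normD f g; rewrite /H2_norm -rmorphD lecR. Qed.

Lemma nrmZ (l : R[i]) f : nrm (l *: f) = normc l * nrm f.
Proof. by apply: complexI; rewrite rmorphM /= -normcE; exact: H2_normZ. Qed.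

Lemma nrmN f : nrm (- f) = nrm f.
Proof. by apply: complexI; exact: (@normrN _ (H2 R) f). Qed.

Lemma nrm0 : nrm 0 = 0.
Proof. by apply: complexI; exact: (@normr0 _ (H2 R)). Qed.

Lemma nrmBC f g : nrm (f - g) = nrm (g - f).
Proof. by rewrite -nrmN opprB. Qed.

Lemma nrm_triangle f g h : nrm (f - h) <= nrm (f - g) + nrm (g - h).
Proof. by apply: le_trans (nrmD _ _); rewrite addrA subrK. Qed.

Lemma nrm_sum (I : Type) (r : seq I) (F : I -> H2 R) :
  nrm (\sum_(i <- r) F i) <= \sum_(i <- r) nrm (F i).
Proof.
elim/big_ind2 : _ => [|x1 x2 y1 y2 hx hy|//]; first by rewrite nrm0.
by apply: le_trans (nrmD _ _) _; exact: lerD.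
Qed.

Lemma H2_addE f g z : (f + g) z = f z + g z. Proof. by []. Qed.
Lemma H2_scaleE (l : R[i]) f z : (l *: f) z = l * f z. Proof. by []. Qed.
Lemma H2_oppE f z : (- f) z = - f z. Proof. by []. Qed.
Lemma H2_0E z : (0 : H2 R) z = 0. Proof. by []. Qed.

Lemma H2_sumE (I : Type) (r : seq I) (F : I -> H2 R) z :
  (\sum_(i <- r) F i) z = \sum_(i <- r) F i z.
Proof. by elim/big_rec2 : _ => // i y1 y2 _ <-. Qed.

Lemma H2_ext f g : (forall z, f z = g z) -> f = g.
Proof. by move=> fg; apply/val_inj/funext. Qed.

Lemma coefN f n : coef (- f) n = - coef f n.
Proof. by rewrite -scaleN1r coefZ mulN1r. Qed.

Lemma coefB f g n : coef (f - g) n = coef f n - coef g n.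
Proof. by rewrite coefD coefN. Qed.

Lemma psum_le_sqr_norm f N :
  \sum_(0 <= n < N) normc (coef f n) ^+ 2 <= sqr_norm f.
Proof.
have nd : nondecreasing_seq (series (fun n => normc (coef f n) ^+ 2)).
  by apply: nondecreasing_series => k _ _; rewrite sqr_ge0.
exact: (nondecreasing_cvgn_le nd (coef_square_summable f) N).
Qed.

Lemma sqr_norm_le f M :
  (forall N, \sum_(0 <= n < N) normc (coef f n) ^+ 2 <= M) -> sqr_norm f <= M.
Proof.
by move=> h; apply: limr_le; [exact: coef_square_summable f|exact: nearW].
Qed.

Lemma nrm_le f M : 0 <= M -> (sqr_norm f <= M ^+ 2) = (nrm f <= M).
Proof. by move=> M0; rewrite -sqr_nrm ler_sqr ?nnegrE ?nrm_ge0. Qed.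

Lemma coef_le_nrm f n : normc (coef f n) <= nrm f.
Proof.
by rewrite -ler_sqr ?nnegrE ?normc_ge0 ?nrm_ge0// sqr_nrm coef_le_sqr_norm.
Qed.

Lemma square_summable_of_psum a M :
  (forall N, \sum_(0 <= n < N) normc (a n) ^+ 2 <= M) -> square_summable a.
Proof.
move=> h; apply: nondecreasing_is_cvgn.
  by apply: nondecreasing_series => k _ _; rewrite sqr_ge0.
by exists M => _ [n _ <-]; exact: h.
Qed.

Lemma sum_geometric_le (r : R) N : 0 <= r -> r < 1 ->
  \sum_(0 <= k < N) r ^+ k <= (1 - r)^-1.
Proof.
move=> r0 r1; have r1' : 0 < 1 - r by rewrite subr_gt0.
rewrite -[leRHS]mul1r ler_pdivlMr// mulrC -opprB mulNr big_mkord -subrX1.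
by rewrite opprB gerBl exprn_ge0.
Qed.

(** Square-summable coefficients are bounded, so that their power series
    converges absolutely on the disk: [H^2] is all of [l^2]. *)
Lemma exists_H2_of_coef a : square_summable a -> exists f, coef f = a.
Proof.
move=> ha; have [M M0 aM] := square_summable_bounded ha.
have /choice[F hF] : forall z : disk R, exists l : R[i],
    (series (fun n => a n * pt z ^+ n) : nat -> R[i]^o) @ \oo --> (l : R[i]^o).
  move=> z; apply: complex_normed_cvg; apply: nondecreasing_is_cvgn.
    by apply: nondecreasing_series => k _ _; rewrite normc_ge0.
  exists (M * (1 - normc (pt z))^-1) => _ [n _ <-].
  apply: le_trans (_ : _ <= M * \sum_(0 <= k < n) normc (pt z) ^+ k) _.
    rewrite mulr_sumr; apply: ler_sum => k _; rewrite normcM normcX.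
    by rewrite ler_wpM2r ?exprn_ge0 ?normc_ge0.
  by rewrite ler_wpM2l ?(ltW M0)// sum_geometric_le ?normc_ge0 ?disk_normc.
have hh : F \in hardyb by apply/asboolP; exists a.
by exists (MkH2 hh); apply: coefP.
Qed.

Lemma cvg_power_series f (z : disk R) :
  (fun N => normc (\sum_(0 <= n < N) coef f n * pt z ^+ n - f z)) @ \oo --> (0 : R).
Proof. by have /cvgCP := coef_power_series f z. Qed.

(** Point evaluations are bounded: every coefficient is at most the norm, and
    the geometric series sums the rest. *)
Lemma eval_le f (z : disk R) : normc (f z) <= nrm f / (1 - normc (pt z)).
Proof.
have h := @cvg_power_series f z.
apply/ler_addgt0Pr => e e0.
have [N _ /(_ _ (leqnn _)) hN] : \forall n \near \oo,
    normc (\sum_(0 <= k < n) coef f k * pt z ^+ k - f z) < e.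
  move/cvgrPdist_lt : h => /(_ _ e0); apply: filterS => n.
  by rewrite sub0r normrN ger0_norm ?normc_ge0.
set s := \sum_(_ <= _ < _) _ in hN.
apply: le_trans (_ : normc s + normc (f z - s) <= _).
  by rewrite -{1}(subrK s (f z)) addrC; exact: normcD.
apply: lerD; last by rewrite normcBC; exact: ltW.
apply: le_trans (normc_sum _ _ _) _.
apply: le_trans (_ : _ <= nrm f * \sum_(0 <= k < N) normc (pt z) ^+ k) _.
  rewrite mulr_sumr; apply: ler_sum => k _; rewrite normcM normcX.
  by rewrite ler_wpM2r ?exprn_ge0 ?normc_ge0// coef_le_nrm.
by rewrite ler_wpM2l ?nrm_ge0// sum_geometric_le ?normc_ge0 ?disk_normc.
Qed.

(** A Cauchy sequence of reals with explicit moduli [rho] has as limit the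
    supremum of the lower bounds [x k - rho k]. *)
Lemma real_nested_limit (x rho : nat -> R) :
  (forall k m, (k <= m)%N -> `|x m - x k| <= rho k) ->
  exists l, forall k, `|l - x k| <= rho k.
Proof.
move=> h.
have le j k : x j - rho j <= x k + rho k.
  have [jk|/ltnW kj] := leqP j k.
    have := h _ _ jk; have := h _ _ (leqnn k); rewrite subrr normr0.
    by rewrite ler_norml => ? /andP[]; lra.
  have := h _ _ kj; have := h _ _ (leqnn j); rewrite subrr normr0.
  by rewrite ler_norml => ? /andP[]; lra.
pose S := range (fun j => x j - rho j).
have S0 : S !=set0 by exists (x 0%N - rho 0%N), 0%N.
have Sub k : ubound S (x k + rho k) by move=> _ [j _ <-].
exists (sup S) => k.
have h1 : x k - rho k <= sup S.
  by apply: ub_le_sup; [exists (x 0%N + rho 0%N); exact: Sub|exists k].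
have h2 : sup S <= x k + rho k by apply: ge_sup => //; exact: Sub.
by rewrite ler_norml; apply/andP; split; lra.
Qed.

Lemma complex_nested_limit (x : nat -> R[i]) (rho : nat -> R) :
  (forall k m, (k <= m)%N -> normc (x m - x k) <= rho k) ->
  exists l, forall k, normc (l - x k) <= 2 * rho k.
Proof.
move=> h.
have [k m km|u hu] := @real_nested_limit (fun k => Re (x k)) rho.
  by apply: le_trans (h _ _ km); rewrite -raddfB; exact: normc_Re.
have [k m km|v hv] := @real_nested_limit (fun k => Im (x k)) rho.
  by apply: le_trans (h _ _ km); rewrite -raddfB; exact: normc_Im.
exists (u +i* v) => k; apply: le_trans (normc_le_ReIm _) _.
by have := hu k; have := hv k; case: (x k) => p q /=; lra.
Qed.

Lemma sqr_triangle_le (P Q D r s : R) : 0 <= P -> 0 <= Q -> 0 <= D ->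
  P <= Q + D -> Q <= 2 * r -> D <= s -> P ^+ 2 <= D ^+ 2 + (4 * r * s + 4 * r * r).
Proof.
move=> P0 Q0 D0 PQD Qr Ds.
have s1 : P ^+ 2 <= (Q + D) ^+ 2 by rewrite ler_sqr ?nnegrE ?addr_ge0.
have s2 : Q * D <= (2 * r) * s by exact: ler_pM.
have s3 : Q * Q <= (2 * r) * (2 * r) by exact: ler_pM.
by apply: le_trans s1 _; lra.
Qed.

(** Completeness of [H^2] in the form used for nested balls: the coefficients
    converge one by one, and the bounds on finite sums of squares pass to the
    limit. *)
Lemma H2_nested_limit (F : nat -> H2 R) (rho : nat -> R) :
  rho @ \oo --> (0 : R) ->
  (forall k m, (k <= m)%N -> nrm (F m - F k) <= rho k) ->
  exists f, forall k, nrm (f - F k) <= rho k.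
Proof.
move=> rho0 h.
have rho_ge0 k : 0 <= rho k by apply: le_trans (h _ _ (leqnn k)); exact: nrm_ge0.
have /choice[a ha] : forall n, exists l, forall k, normc (l - coef (F k) n) <= 2 * rho k.
  move=> n; apply: complex_nested_limit => k m km.
  by apply: le_trans (h _ _ km); rewrite -coefB; exact: coef_le_nrm.
have key k N : \sum_(0 <= n < N) normc (a n - coef (F k) n) ^+ 2 <= rho k ^+ 2.
  have lim : (fun m => rho k ^+ 2 + N%:R * (4 * rho m * rho k + 4 * rho m * rho m))
      @ \oo --> rho k ^+ 2 + N%:R * (4 * 0 * rho k + 4 * 0 * 0).
    apply: cvgD; first exact: cvg_cst.
    apply: cvgM; first exact: cvg_cst.
    apply: cvgD; apply: cvgM; try exact: cvg_cst; try exact: rho0.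
      by apply: cvgM; [exact: cvg_cst|exact: rho0].
    by apply: cvgM; [exact: cvg_cst|exact: rho0].
  rewrite !mulr0 mul0r !addr0 mulr0 addr0 in lim.
  rewrite -(cvg_lim _ lim)//; apply: limr_ge; first by apply/cvg_ex; eexists; exact: lim.
  exists k => // m /= km.
  have hs : \sum_(0 <= n < N) normc (coef (F m) n - coef (F k) n) ^+ 2 <= rho k ^+ 2.
    apply: le_trans (_ : sqr_norm (F m - F k) <= _).
      apply: le_trans (psum_le_sqr_norm _ N).
      by apply: ler_sum => n _; rewrite coefB.
    by rewrite nrm_le ?rho_ge0// h.
  apply: le_trans (lerD hs (lexx _)).
  have -> : N%:R * (4 * rho m * rho k + 4 * rho m * rho m) =
     \sum_(0 <= n < N) (4 * rho m * rho k + 4 * rho m * rho m).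
    by rewrite sumr_const_nat subn0 mulr_natl.
  rewrite -big_split /=; apply: ler_sum => n _.
  have h1 := ha n m.
  have h2 : normc (coef (F m) n - coef (F k) n) <= rho k.
    by apply: le_trans (h _ _ km); rewrite -coefB; exact: coef_le_nrm.
  have h3 : normc (a n - coef (F k) n) <=
      normc (a n - coef (F m) n) + normc (coef (F m) n - coef (F k) n).
    by apply: le_trans (normcD _ _); rewrite addrA subrK.
  exact: (sqr_triangle_le (normc_ge0 _) (normc_ge0 _) (normc_ge0 _) h3 h1 h2).
(* Only differences are known to be square summable, hence the detour by
   [F 0]. *)
have [f0 hf0] : exists f0, coef f0 = fun n => a n - coef (F 0%N) n.
  by apply: exists_H2_of_coef; apply: square_summable_of_psum (key 0%N).
exists (f0 + F 0%N) => k; rewrite -nrm_le//; apply: sqr_norm_le => N.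
apply: le_trans (key k N); apply: ler_sum => n _.
by rewrite coefB coefD hf0 subrK.
Qed.

End hardy_space.

(** * Multiplication by a linear fractional self-map of the disk *)

Section energy.
Context {R : realType}.
Implicit Types (a b c d x y : R[i]) (f g h : H2 R).

(** The energy identity behind all norm bounds: the difference of two squared
    moduli of linear forms is a Hermitian form. *)
Lemma energy_identity a b c d x y :
  normc (c * x + d * y) ^+ 2 - normc (a * x + b * y) ^+ 2 =
  (normc c ^+ 2 - normc a ^+ 2) * normc x ^+ 2 +
  (normc d ^+ 2 - normc b ^+ 2) * normc y ^+ 2 +
  2 * Re ((c * conjc d - a * conjc b) * (x * conjc y)).
Proof.
rewrite !sqr_normcE; case: a b c d x y => [a a'] [b b'] [c c'] [d d'] [x x'] [y y'] /=.
by ring.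
Qed.

Lemma Re_mul_ge x y z : - (normc x * (normc y ^+ 2 + normc z ^+ 2)) <=
  2 * Re (x * (y * conjc z)).
Proof.
have : - normc (x * (y * conjc z)) <= Re (x * (y * conjc z)).
  by rewrite lerNl (le_trans _ (normc_Re _))// -normrN ler_norm.
have -> : normc (x * (y * conjc z)) = normc x * (normc y * normc z).
  by rewrite !normcM; congr (_ * (_ * _)); case: z => p q /=; rewrite sqrrN.
have := normc_ge0 x; move: (Re _) (normc x) (normc y) (normc z) => r u v w u0 h.
have : 0 <= u * (v - w) ^+ 2 by rewrite mulr_ge0 ?sqr_ge0.
rewrite sqrrB mulr2n; lra.
Qed.

(** Inequalities on the open disk reach the unit circle through the radial
    limit [r -> 1], which this replaces by an explicit [r = 1 - e]. *)
Lemma quadratic_ge0_at1 (A B C : R) :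
  (forall r, 0 < r -> r < 1 -> 0 <= A + r * B + r ^+ 2 * C) -> 0 <= A + B + C.
Proof.
move=> h; rewrite leNgt; apply/negP => neg.
pose K := `|B| + 3 * `|C| + 1; pose D := - (A + B + C).
have D0 : 0 < D by rewrite oppr_gt0.
have K1 : 1 <= K by rewrite /K lerDr addr_ge0// mulr_ge0.
have DK : 0 < D + K by lra.
pose e := D / (D + K).
have e0 : 0 < e by rewrite divr_gt0.
have e1 : e < 1 by rewrite ltr_pdivrMr// mul1r; lra.
have eK : e * K < D.
  by rewrite /e mulrAC ltr_pdivrMr// ltr_pM2l//; lra.
have r0 : 0 < 1 - e by lra.
have r1 : 1 - e < 1 by lra.
have := h _ r0 r1.
have hB : - (e * `|B|) <= e * B.
  by rewrite -mulrN ler_wpM2l ?(ltW e0)// lerNl -normrN ler_norm.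
have hC : - (e * `|C|) <= e * C.
  by rewrite -mulrN ler_wpM2l ?(ltW e0)// lerNl -normrN ler_norm.
have hC2 : e * (e * C) <= e * `|C|.
  rewrite ler_wpM2l ?(ltW e0)//; apply: le_trans (_ : e * `|C| <= _).
    by rewrite ler_wpM2l ?(ltW e0)// ler_norm.
  by rewrite -[leRHS]mul1r ler_wpM2r// ltW.
have eKE : e * K = e * `|B| + 3 * (e * `|C|) + e by rewrite /K; ring.
have -> : A + (1 - e) * B + (1 - e) ^+ 2 * C =
   A + B + C - e * B - 2 * (e * C) + e * (e * C) by ring.
move: eK hB hC hC2; rewrite eKE /D; lra.
Qed.

Variables (a b c d : R[i]).
Hypothesis nopole : forall z : disk R, c * pt z + d != 0.
Hypothesis selfmap : forall z : disk R,
  normc (a * pt z + b) <= normc (c * pt z + d).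
Hypothesis det : a * d - b * c != 0.

(** A pole on the unit circle would have to be cancelled by a zero of the
    numerator, against [a * d - b * c != 0]. *)
Lemma pole_outside : normc c < normc d.
Proof.
rewrite ltNge; apply/negP => dc.
have [c0|c0] := eqVneq c 0.
  move: dc; rewrite c0 normc0 le_eqVlt ltNge normc_ge0 orbF normc_eq0 => /eqP d0.
  by move: det; rewrite c0 d0 !mulr0 subrr eqxx.
have [u cu u1] : exists2 u, c * u = - d & normc u <= 1.
  exists (- d / c); first by rewrite mulrC divfK.
  by rewrite normcM normcN normcV ler_pdivrMr ?normc_gt0// mul1r.
move: u1; rewrite le_eqVlt => /predU1P[u1|u1]; last first.
  by have := nopole (in_disk u1); rewrite /= cu addNr eqxx.
have small r : 0 < r -> r < 1 ->
    0 <= (normc a + normc d - normc (a * u + b)) + r * - (normc a + normc d) + r ^+ 2 * 0.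
  move=> r0 r1.
  have ru : normc (r%:C * u) < 1 by rewrite normcM u1 mulr1 normc_real ?ltW.
  have := selfmap (in_disk ru); rewrite /= => h1.
  have e1 : c * (r%:C * u) + d = (1 - r)%:C * d.
    by rewrite mulrCA cu rmorphB /= rmorph1; ring.
  have e2 : a * u + b = (a * (r%:C * u) + b) + (1 - r)%:C * (a * u).
    by rewrite rmorphB /= rmorph1; ring.
  have r1' : 0 <= 1 - r by lra.
  have h2 : normc (a * u + b) <= (1 - r) * normc d + (1 - r) * normc a.
    rewrite e2; apply: le_trans (normcD _ _) _; apply: lerD.
      by apply: le_trans h1 _; rewrite e1 normcM normc_real.
    by rewrite !normcM u1 mulr1 normc_real.
  by lra.
have := quadratic_ge0_at1 small.
have := normc_ge0 (a * u + b) => n0 n1.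
have /eqP : normc (a * u + b) = 0 by apply/eqP; rewrite eq_le n0 andbT; lra.
rewrite normc_eq0 => /eqP aub.
have : c * (a * u + b) = 0 by rewrite aub mulr0.
rewrite mulrDr mulrCA cu => e; move/eqP: det; apply.
by rewrite -[RHS]oppr0 -e; ring.
Qed.

(** On the unit circle [|c u + d|^2 - |a u + b|^2] is a constant plus the real
    part of [2 m u]; it is nonnegative for all [u] exactly when the constant is
    at least [2 |m|]. *)
Lemma boundary_energy_ge0 :
  2 * normc (c * conjc d - a * conjc b) <=
  (normc c ^+ 2 - normc a ^+ 2) + (normc d ^+ 2 - normc b ^+ 2).
Proof.
set P := normc c ^+ 2 - _; set Q := normc d ^+ 2 - _; set m := _ - _.
(* [w] is the point of the circle where the real part of [m w] is least. *)
have [w w1 mw] : exists2 w, normc w = 1 & m * w = - (normc m)%:C.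
  have [->|m0] := eqVneq m 0.
    by exists 1; [rewrite normc1|rewrite normc0 oppr0 mul0r].
  exists (- (normc m)%:C / m).
    by rewrite normcM normcN normcV normc_real ?normc_ge0// divff ?normc_eq0.
  by rewrite mulrC divfK.
suff : 0 <= Q + - (2 * normc m) + P by lra.
apply: quadratic_ge0_at1 => r r0 r1.
have rw : normc (r%:C * w) < 1 by rewrite normcM w1 mulr1 normc_real ?ltW.
have /= := selfmap (in_disk rw).
rewrite -ler_sqr ?nnegrE ?normc_ge0// -subr_ge0.
have := energy_identity a b c d (r%:C * w) 1; rewrite !mulr1 => ->.
rewrite -/P -/Q -/m normcM w1 normc_real ?(ltW r0)// mulr1 normc1 expr1n.
have -> : m * (r%:C * w * conjc 1) = (- (r * normc m))%:C.
  rewrite (_ : conjc 1 = 1 :> R[i]); last by rewrite /= oppr0.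
  by rewrite mulr1 mulrCA mw rmorphN rmorphM /=; ring.
by rewrite /=; lra.
Qed.

End energy.

Arguments ComplexField.Normc.normc : simpl never.
Opaque coef ComplexField.Normc.normc.

Section multiplication.
Context {R : realType}.
Implicit Types (f g h : H2 R).

Definition seq_shift (a : nat -> R[i]) n := if n is m.+1 then a m else 0.

Lemma psum_seq_shift_le a N :
  \sum_(0 <= n < N) normc (seq_shift a n) ^+ 2 <= \sum_(0 <= n < N) normc (a n) ^+ 2.
Proof.
case: N => [|N]; first by rewrite !big_geq.
rewrite big_nat_recl//= normc0 expr0n add0r big_nat_recr//=.
by rewrite lerDl sqr_ge0.
Qed.

Lemma square_summable_shift (a : nat -> R[i]) :
  square_summable a -> square_summable (seq_shift a).
Proof.
move=> ha; apply: (@square_summable_of_psum _ _ (limn (series (fun n => normc (a n) ^+ 2)))).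
move=> N; apply: le_trans (psum_seq_shift_le a N) _.
apply: nondecreasing_cvgn_le ha N.
by apply: nondecreasing_series => k _ _; rewrite sqr_ge0.
Qed.

Lemma power_series_of_shift (f : disk R -> R[i]) (a : nat -> R[i]) :
  power_series_of f a ->
  power_series_of (fun z => pt z * f z) (seq_shift a).
Proof.
move=> fa z; apply/cvgCP; have /cvgCP h := fa z.
rewrite -(cvg_shiftS (fun n => normc (_ n - _))) /=.
have -> : (fun n => normc (series (fun n0 => seq_shift a n0 * pt z ^+ n0) n.+1
    - pt z * f z)) =
  (fun n => normc (pt z) * normc (series (fun n => a n * pt z ^+ n) n - f z)).
  apply/funext => n; rewrite -normcM mulrBr /series /= big_nat_recl//= mul0r add0r.
  rewrite mulr_sumr; congr (normc (_ - _)); apply: eq_bigr => k _.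
  by rewrite exprS mulrCA.
suff : (fun n => normc (pt z) * normc (series (fun n => a n * pt z ^+ n) n - f z))
    @ \oo --> normc (pt z) * 0 by rewrite mulr0.
by apply: cvgM; [exact: cvg_cst|exact: h].
Qed.

Lemma shift_subproof f : (fun z => pt z * f z) \in hardyb.
Proof.
apply/asboolP; exists (seq_shift (coef f)); split.
  exact/square_summable_shift/coef_square_summable.
exact/power_series_of_shift/coef_power_series.
Qed.

Definition shift f : H2 R := MkH2 (shift_subproof f).

Lemma shiftE f z : shift f z = pt z * f z. Proof. by []. Qed.

Lemma coef_shift f : coef (shift f) = seq_shift (coef f).
Proof.
apply: coefP; first exact/square_summable_shift/coef_square_summable.
exact/power_series_of_shift/coef_power_series.
Qed.

Definition psum f N : R := \sum_(0 <= n < N) normc (coef f n) ^+ 2.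

Lemma cvg_sqr_norm f : psum f @ \oo --> sqr_norm f.
Proof. exact: (coef_square_summable f). Qed.

Lemma sqr_norm_shift f : sqr_norm (shift f) = sqr_norm f.
Proof.
apply/eqP; rewrite eq_le; apply/andP; split; apply: sqr_norm_le => N.
  rewrite coef_shift; apply: le_trans (psum_seq_shift_le _ N) _.
  exact: psum_le_sqr_norm.
apply: le_trans (psum_le_sqr_norm (shift f) N.+1).
by rewrite coef_shift big_nat_recl//= lerDr sqr_ge0.
Qed.

Lemma nrm_shift f : nrm (shift f) = nrm f.
Proof. by rewrite /nrm sqr_norm_shift. Qed.

Lemma one_power_series : power_series_of (fun=> 1 : R[i]) (fun n => (n == 0%N)%:R).
Proof.
move=> z; apply/cvgCP; apply: cvg_near_cst; exists 1%N => // n /= n1.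
rewrite /series /= (big_cat_nat (n := 1))//= big_nat1 expr0 mulr1.
rewrite big_nat_cond big1 ?addr0 ?subrr ?normc0//.
by move=> [|k] //= _; rewrite mul0r.
Qed.

Lemma one_psum N : \sum_(0 <= n < N) normc ((n == 0%N)%:R : R[i]) ^+ 2 <= 1.
Proof.
case: N => [|N]; first by rewrite big_geq.
rewrite big_nat_recl//= big1; last by move=> k _; rewrite normc0 expr0n.
by rewrite addr0 normc1 expr1n.
Qed.

Lemma one_subproof : (fun=> 1 : R[i]) \in @hardyb R.
Proof.
apply/asboolP; exists (fun n => (n == 0%N)%:R); split; last exact: one_power_series.
exact: (square_summable_of_psum one_psum).
Qed.

Definition one : H2 R := MkH2 one_subproof.

Lemma coef_one n : coef one n = (n == 0%N)%:R.
Proof.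
have -> // := @coefP _ one (fun n => (n == 0%N)%:R); last exact: one_power_series.
exact: (square_summable_of_psum one_psum).
Qed.

Lemma nrm_one_le1 : nrm one <= 1.
Proof.
rewrite -nrm_le// expr1n; apply: sqr_norm_le => N.
by under eq_bigr do rewrite coef_one; exact: one_psum.
Qed.

Lemma coef0E f (z : disk R) : pt z = 0 -> f z = coef f 0.
Proof.
move=> z0; apply/eqP; rewrite -subr_eq0 -normc_eq0 normcBC; apply/eqP.
apply: (cvg_unique _ _ (@cvg_power_series _ f z)) => //.
apply: cvg_near_cst; exists 1%N => // n /= n1.
rewrite (big_cat_nat (n := 1))//= big_nat1 expr0 mulr1 z0.
by rewrite big_nat_cond big1 ?addr0// => -[|k] //= _; rewrite expr0n mulr0.
Qed.

Lemma psum_eq_tail (u v : nat -> R[i]) N : (forall k, u k.+1 = v k.+1) ->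
  \sum_(0 <= k < N.+1) normc (u k) ^+ 2 =
  \sum_(0 <= k < N.+1) normc (v k) ^+ 2 - normc (v 0%N) ^+ 2 + normc (u 0%N) ^+ 2.
Proof.
move=> uv; rewrite !big_nat_recl// (eq_bigr (fun k => normc (v k.+1) ^+ 2)).
  by ring.
by move=> k _; rewrite uv.
Qed.

(** Only the constant coefficient changes when a constant is added. *)
Lemma sqr_norm_addc f (c : R[i]) : sqr_norm (f + c *: one) =
  sqr_norm f - normc (coef f 0) ^+ 2 + normc (coef f 0 + c) ^+ 2.
Proof.
set r := RHS; suff : psum (f + c *: one) @ \oo --> r.
  exact: (cvg_lim (@Rhausdorff R)).
rewrite -cvg_shiftS /r.
have -> : (fun n => psum (f + c *: one) n.+1) =
    (fun n => psum f n.+1 - normc (coef f 0) ^+ 2 + normc (coef f 0 + c) ^+ 2).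
  apply/funext => n.
  have -> : coef f 0 + c = coef (f + c *: one) 0.
    by rewrite coefD coefZ coef_one mulr1.
  apply: psum_eq_tail => k.
  by rewrite coefD coefZ coef_one mulr0 addr0.
apply: cvgD; last exact: cvg_cst.
apply: cvgB; last exact: cvg_cst.
by rewrite (cvg_shiftS (psum f)); exact: cvg_sqr_norm.
Qed.

Definition affine_mul (c d : R[i]) f : H2 R := c *: shift f + d *: f.

Lemma affine_mulE c d f z : affine_mul c d f z = (c * pt z + d) * f z.
Proof. by rewrite H2_addE !H2_scaleE shiftE mulrDl mulrA. Qed.

Lemma coef_affine_mul c d f n :
  coef (affine_mul c d f) n = c * seq_shift (coef f) n + d * coef f n.
Proof. by rewrite coefD !coefZ coef_shift. Qed.

Opaque sqr_norm shift one affine_mul.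

(** Summing the energy identity over the coefficients, the cross term is
    dominated by the diagonal ones precisely under the inequality that the
    moduli satisfy on the unit circle. *)
Lemma sqr_norm_affine_mul_le (a b c d : R[i]) h :
  2 * normc (c * conjc d - a * conjc b) <=
    (normc c ^+ 2 - normc a ^+ 2) + (normc d ^+ 2 - normc b ^+ 2) ->
  sqr_norm (affine_mul a b h) <= sqr_norm (affine_mul c d h).
Proof.
set P := normc c ^+ 2 - _; set Q := normc d ^+ 2 - _; set m := normc (_ - _).
move=> hm.
have H : sqr_norm (affine_mul a b h) + (P - m) * sqr_norm (shift h)
    + (Q - m) * sqr_norm h <= sqr_norm (affine_mul c d h).
  have lhs : (fun N => psum (affine_mul a b h) N + (P - m) * psum (shift h) N
      + (Q - m) * psum h N) @ \oo --> sqr_norm (affine_mul a b h)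
      + (P - m) * sqr_norm (shift h) + (Q - m) * sqr_norm h.
    apply: cvgD; first apply: cvgD.
    - exact: cvg_sqr_norm.
    - by apply: cvgM; [exact: cvg_cst|exact: cvg_sqr_norm].
    - by apply: cvgM; [exact: cvg_cst|exact: cvg_sqr_norm].
  have cvgR := @cvg_sqr_norm (affine_mul c d h).
  apply: (ler_cvg_to lhs cvgR).
  apply: nearW => N; rewrite /psum !mulr_sumr -!big_split /=.
  apply: ler_sum => n _; rewrite !coef_affine_mul coef_shift.
  set x := seq_shift _ n; set y := coef h n.
  have := energy_identity a b c d x y.
  have := Re_mul_ge (c * conjc d - a * conjc b) x y.
  by rewrite -/P -/Q -/m; lra.
rewrite sqr_norm_shift in H.
have : 0 <= (P + Q - 2 * m) * sqr_norm h by rewrite mulr_ge0 ?sqr_norm_ge0// subr_ge0.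
move: (sqr_norm _) (sqr_norm (affine_mul c d h)) (sqr_norm h) H => x y z.
by move: P Q m {hm} => P Q m; lra.
Qed.

(** The pole [-d / c] lies outside the closed disk, and
    [|c p + d q|^2 >= (|d| - |c|) (|d| |q|^2 - |c| |p|^2)] can be
    summed over consecutive coefficients [p], [q] of the quotient: dividing by
    [c z + d] costs at most a factor [1 / (|d| - |c|)] in norm. *)
Lemma affine_div (c d : R[i]) f : normc c < normc d ->
  exists h, affine_mul c d h = f.
Proof.
move=> cd.
have d0 : d != 0 by rewrite -normc_gt0; apply: le_lt_trans cd; exact: normc_ge0.
pose fix s n := if n is m.+1 then (coef f m.+1 - c * s m) / d else coef f 0 / d.
have sE n : coef f n = c * seq_shift s n + d * s n.
  by case: n => [|n] /=; rewrite [d * _]mulrC divfK// ?mulr0 ?add0r// addrC subrK.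
have dc0 : 0 < normc d - normc c by rewrite subr_gt0.
have bnd N : \sum_(0 <= n < N) normc (s n) ^+ 2 <=
    sqr_norm f / (normc d - normc c) ^+ 2.
  rewrite ler_pdivlMr ?exprn_gt0// mulrC.
  apply: le_trans (psum_le_sqr_norm f N).
  have : 0 <= normc c * (normc d - normc c) *
      (\sum_(0 <= n < N) normc (s n) ^+ 2 - \sum_(0 <= n < N) normc (seq_shift s n) ^+ 2).
    by rewrite mulr_ge0 ?subr_ge0 ?psum_seq_shift_le// mulr_ge0 ?normc_ge0// ltW.
  rewrite mulrBr => h1.
  apply: (@le_trans _ _ (normc d * (normc d - normc c) * \sum_(0 <= n < N) normc (s n) ^+ 2
    - normc c * (normc d - normc c) * \sum_(0 <= n < N) normc (seq_shift s n) ^+ 2)).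
    by rewrite expr2; lra.
  rewrite !mulr_sumr -sumrB; apply: ler_sum => n _; rewrite sE.
  set p := seq_shift s n; set q := s n.
  have h2 : normc d * normc q - normc c * normc p <= normc (c * p + d * q).
    have := normcB_ge (d * q) (- (c * p)).
    by rewrite opprK normcN !normcM addrC [d * q + _]addrC addrC.
  have h3 : normc c * normc p - normc d * normc q <= normc (c * p + d * q).
    by have := normcB_ge (c * p) (- (d * q)); rewrite opprK normcN !normcM.
  have h4 : (normc d * normc q - normc c * normc p) ^+ 2 <= normc (c * p + d * q) ^+ 2.
    rewrite -[leLHS]real_normK ?num_real// ler_sqr ?nnegrE ?normc_ge0//.
    by rewrite ler_norml; apply/andP; split; lra.
  apply: le_trans h4.
  have : 0 <= normc c * normc d * (normc p - normc q) ^+ 2.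
    by rewrite mulr_ge0 ?sqr_ge0// mulr_ge0 ?normc_ge0.
  by rewrite !sqrrB !mulr2n; nra.
have [h hs] := exists_H2_of_coef (square_summable_of_psum bnd).
by exists h; apply: coef_inj; apply/funext => n; rewrite coef_affine_mul hs -sE.
Qed.

(** Von Neumann's inequality for a linear fractional symbol [phi]: writing
    [f = (c z + d) h], the product [phi f] is [(a z + b) h]. *)
Lemma contractive_multiplier (phi : disk R -> disk R) f : linear_fractional phi ->
  exists2 g : H2 R, (forall z, g z = pt (phi z) * f z) & nrm g <= nrm f.
Proof.
move=> /linear_fractionalP[a [b [c [d [det nopole hphi]]]]].
have selfmap (z : disk R) : normc (a * pt z + b) <= normc (c * pt z + d).
  have := disk_normc (phi z).
  by rewrite hphi normcM normcV ltr_pdivrMr ?normc_gt0// mul1r => /ltW.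
have [h hf] := affine_div f (pole_outside nopole selfmap det).
exists (affine_mul a b h).
  move=> z; rewrite hphi.
  by rewrite -hf !affine_mulE mulrA divfK.
rewrite -nrm_le ?nrm_ge0// sqr_nrm -hf.
exact/sqr_norm_affine_mul_le/boundary_energy_ge0.
Qed.

End multiplication.

(** * Composition with a linear fractional self-map *)

Opaque pt.

Section composition.
Context {R : realType}.
Implicit Types (f g h : H2 R).

Definition disk0 : disk R := in_disk (x := 0) (eq_ind_r (fun x : R => x < 1) ltr01 normc0).

Lemma eval_disk0 f : f disk0 = coef f 0.
Proof. exact: coef0E. Qed.

Lemma sqr_norm0 : sqr_norm (0 : H2 R) = 0.
Proof. by rewrite -sqr_nrm nrm0 expr0n. Qed.

(** The induction step of the next estimate in real numbers: [s] is the modulus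
    of [phi 0], [x] and [y] those of the old and new constant coefficients. *)
Lemma littlewood_step (s x u y n1 n' S : R) : 0 <= s -> s < 1 ->
  0 <= x -> 0 <= u -> 0 <= y -> n1 <= n' -> y <= s * x + u ->
  (1 - s) ^+ 2 * n' + s * (1 - s) * x ^+ 2 <= S ->
  (1 - s) ^+ 2 * (n1 - (s * x) ^+ 2 + y ^+ 2) + s * (1 - s) * y ^+ 2 <=
    u ^+ 2 + S.
Proof.
move=> s0 s1 x0 u0 y0 nn hy IHS.
have s1' : 0 <= 1 - s by lra.
have y2 : y ^+ 2 <= (s * x + u) ^+ 2.
  by rewrite ler_sqr ?nnegrE// addr_ge0// mulr_ge0.
have key : (1 - s) * y ^+ 2 <= u ^+ 2 + s * (1 - s) * x ^+ 2.
  apply: le_trans (ler_wpM2l s1' y2) _.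
  have -> : (1 - s) * (s * x + u) ^+ 2 =
    u ^+ 2 + s * (1 - s) * x ^+ 2 - s * (u - (1 - s) * x) ^+ 2 by ring.
  by rewrite gerBl mulr_ge0// sqr_ge0.
have drop : (1 - s) ^+ 2 * (n1 - (s * x) ^+ 2 + y ^+ 2) <= (1 - s) ^+ 2 * (n' + y ^+ 2).
  rewrite ler_wpM2l ?sqr_ge0//; have := sqr_ge0 (s * x); lra.
apply: le_trans (lerD drop (lexx _)) _.
have -> : (1 - s) ^+ 2 * (n' + y ^+ 2) + s * (1 - s) * y ^+ 2 =
  (1 - s) ^+ 2 * n' + (1 - s) * y ^+ 2 by ring.
lra.
Qed.

Variable phi : disk R -> disk R.
Hypothesis hphi : linear_fractional phi.
Let r := normc (pt (phi disk0)).

Let r_ge0 : 0 <= r. Proof. exact: normc_ge0. Qed.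
Let r_lt1 : r < 1. Proof. exact: disk_normc. Qed.

(** A weighted form of Littlewood's subordination principle, by Horner's scheme
    [p = p 0 + z q]: multiplication by [phi] is a contraction, and the term in
    the constant coefficient absorbs the failure of [1] and [phi q(phi)] to be
    orthogonal when [phi 0 != 0]. *)
Lemma comp_poly (a : nat -> R[i]) N : exists2 g : H2 R,
  forall z, g z = \sum_(0 <= n < N) a n * pt (phi z) ^+ n &
  (1 - r) ^+ 2 * sqr_norm g + r * (1 - r) * normc (coef g 0) ^+ 2 <=
    \sum_(0 <= n < N) normc (a n) ^+ 2.
Proof.
elim: N a => [|N IH] a.
  exists 0; first by move=> z; rewrite big_geq.
  by rewrite big_geq// sqr_norm0 -eval_disk0 H2_0E normc0 expr0n !mulr0 addr0.
have [g' g'E g'N] := IH (fun n => a n.+1).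
have [g1 g1E g1N] := contractive_multiplier g' hphi.
exists (g1 + a 0%N *: one).
  move=> z; rewrite H2_addE H2_scaleE g1E g'E big_nat_recl// expr0 !mulr1 addrC.
  congr (_ + _); rewrite mulr_sumr; apply: eq_bigr => k _.
  by rewrite exprS mulrCA.
have g0 : coef (g1 + a 0%N *: one) 0 = coef g1 0 + a 0%N.
  by rewrite coefD coefZ coef_one mulr1.
have g10 : normc (coef g1 0) = r * normc (coef g' 0).
  by rewrite -!eval_disk0 g1E normcM.
have hN : sqr_norm g1 <= sqr_norm g'.
  by rewrite -!sqr_nrm ler_sqr ?nnegrE ?nrm_ge0.
have hy := normcD (coef g1 0) (a 0%N).
rewrite sqr_norm_addc big_nat_recl// g0.
move: (normc (coef g1 0 + _)) (normc_ge0 (coef g1 0 + a 0%N)) hy => y y0.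
rewrite g10 => hy.
apply: (littlewood_step r_ge0 r_lt1 (normc_ge0 (coef g' 0)) (normc_ge0 (a 0%N)) y0 hN hy).
exact: g'N.
Qed.

(** The compositions of the partial sums of [f] form a Cauchy sequence by the
    estimate for polynomials, and point evaluations identify its limit. *)
Lemma comp_exists f : exists2 g : H2 R,
  forall z, g z = f (phi z) & nrm g <= nrm f / (1 - r).
Proof.
have r1 : 0 < 1 - r by rewrite subr_gt0.
have /choice[F hF] : forall N, exists g : H2 R,
    forall z, g z = \sum_(0 <= n < N) coef f n * pt (phi z) ^+ n.
  by move=> N; have [g gE _] := comp_poly (coef f) N; exists g.
pose rho k := Num.sqrt (sqr_norm f - psum f k) / (1 - r).
have rho0 : rho @ \oo --> (0 : R).
  suff : rho @ \oo --> Num.sqrt (sqr_norm f - sqr_norm f) / (1 - r).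
    by rewrite subrr sqrtr0 mul0r.
  apply: cvgM; last exact: cvg_cst.
  apply: (@continuous_cvg _ _ _ _ _ _ (@Num.sqrt R)); first exact: sqrt_continuous.
  by apply: cvgB; [exact: cvg_cst|exact: cvg_sqr_norm].
have cauchy k m : (k <= m)%N -> nrm (F m - F k) <= rho k.
  move=> km.
  have [g gE gN] := comp_poly (fun n => if (k <= n)%N then coef f n else 0) m.
  have -> : F m - F k = g.
    apply: H2_ext => z; rewrite H2_addE H2_oppE !hF gE (big_cat_nat (n := k))//=.
    rewrite [in RHS](big_cat_nat (n := k))//= [LHS]addrAC subrr add0r.
    rewrite [X in _ = X + _]big_nat_cond [X in _ = X + _]big1 ?add0r.
      by apply: eq_big_nat => n /andP[-> _].
    by move=> n /andP[/andP[_ nk] _]; rewrite leqNgt nk /= mul0r.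
  rewrite /rho -nrm_le ?divr_ge0 ?sqrtr_ge0 ?(ltW r1)// expr_div_n.
  rewrite ler_pdivlMr ?exprn_gt0//.
  have tail : \sum_(0 <= n < m) normc (if (k <= n)%N then coef f n else 0) ^+ 2 =
      psum f m - psum f k.
    rewrite /psum (big_cat_nat (n := k))//= [in RHS](big_cat_nat (n := k))//=.
    rewrite [RHS]addrAC subrr add0r big_nat_cond big1 ?add0r.
      by apply: eq_big_nat => n /andP[-> _].
    by move=> n /andP[/andP[_ nk] _]; rewrite leqNgt nk /= normc0 expr0n.
  have le : psum f m <= sqr_norm f by exact: psum_le_sqr_norm.
  have pk : psum f k <= sqr_norm f by exact: psum_le_sqr_norm.
  rewrite sqr_sqrtr ?subr_ge0// mulrC.
  have c0 : 0 <= r * (1 - r) * normc (coef g 0) ^+ 2.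
    by rewrite mulr_ge0 ?sqr_ge0// mulr_ge0 ?r_ge0// (ltW r1).
  move: gN; rewrite tail => gN.
  apply: le_trans (_ : psum f m - psum f k <= _); last by rewrite lerD2r.
  by apply: le_trans gN; rewrite lerDl.
have [g hg] := H2_nested_limit rho0 cauchy.
exists g => [z|].
  apply: (@cvgC_unique _ (fun k => F k z)); apply/cvgCP; last first.
    under eq_fun do rewrite hF.
    exact: cvg_power_series.
  have z1 : 0 < 1 - normc (pt z) by rewrite subr_gt0 disk_normc.
  apply: (@squeeze_cvgr _ _ _ _ (fun=> 0) (fun k => rho k / (1 - normc (pt z)))).
  - apply: nearW => k; rewrite normc_ge0 /= normcBC -H2_oppE -H2_addE.
    by apply: le_trans (eval_le _ z) _; rewrite ler_pM2r ?invr_gt0.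
  - exact: cvg_cst.
  - suff : (fun k => rho k / (1 - normc (pt z))) @ \oo --> 0 / (1 - normc (pt z)).
      by rewrite mul0r.
    by apply: cvgM => //; exact: cvg_cst.
have := hg 0%N; rewrite (_ : F 0%N = 0) ?subr0; last first.
  by apply: H2_ext => z; rewrite hF big_geq.
by rewrite /rho /psum big_geq// subr0.
Qed.

Lemma composition_operatorE f z : composition_operator phi f z = f (phi z).
Proof.
rewrite /composition_operator; case: xgetP => [g -> /(_ z)//|].
by have [g gE _] := comp_exists f => /(_ g) []; move=> w; exact: gE.
Qed.

Lemma composition_operator_bound :
  exists2 C : R, 0 < C & forall f, nrm (composition_operator phi f) <= C * nrm f.
Proof.
exists (1 - r)^-1; first by rewrite invr_gt0 subr_gt0.
move=> f; have [g gE gN] := comp_exists f.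
have -> : composition_operator phi f = g.
  by apply: H2_ext => z; rewrite composition_operatorE gE.
by rewrite mulrC.
Qed.

End composition.

(** * Approximation in the Hardy space *)

Opaque nrm sqr_norm.

Section approximation.
Context {R : realType}.
Implicit Types (f g h : H2 R) (S : set (H2 R)).

Lemma open_nrm S f : open S -> S f ->
  exists2 e : R, 0 < e & forall g, nrm (g - f) < e -> S g.
Proof.
rewrite openE => oS /oS /nbhs_ballP[e /= e0 eS].
have [e1 e2] : e = (Re e)%:C /\ 0 < Re e.
  by move: e0; case: e {eS} => a b; rewrite ltcE /= => /andP[/eqP -> ?].
exists (Re e) => // g gf; apply: eS.
by rewrite -ball_normE /ball_ /= e1 nrmE ltcR nrmBC.
Qed.

Definition approximable S f :=
  forall e : R, 0 < e -> exists2 g, S g & nrm (g - f) < e.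

Lemma denseP S : dense S <-> forall f, approximable S f.
Proof.
split=> [dS f e e0|dS O [f Of] oO].
  have e0' : 0 < e%:C :> R[i] by rewrite ltcR.
  have fO : (interior (ball f e%:C)) f by apply: nbhsx_ballx.
  have [g [/interior_subset gf Sg]] := dS _ (ex_intro _ f fO) (open_interior _).
  exists g => //; move: gf.
  by rewrite -ball_normE /ball_ /= nrmE ltcR nrmBC.
have [e e0 eO] := open_nrm oO Of.
by have [g Sg /eO Og] := dS f e e0; exists g.
Qed.

Definition subspace S := [/\ S 0, forall f g, S f -> S g -> S (f + g) &
  forall (l : R[i]) f, S f -> S (l *: f)].

Lemma subspace_sum S (c : nat -> R[i]) (F : nat -> H2 R) N : subspace S ->
  (forall k, S (F k)) -> S (\sum_(0 <= k < N) c k *: F k).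
Proof.
move=> [S0 SD SZ] SF; elim: N => [|N IH]; first by rewrite big_geq.
by rewrite big_nat_recr//=; apply: SD => //; exact: SZ.
Qed.

Lemma approximableW S f : S f -> approximable S f.
Proof. by move=> Sf e e0; exists f => //; rewrite subrr nrm0. Qed.

Lemma approximable_trans S f : approximable (approximable S) f -> approximable S f.
Proof.
move=> h e e0; have e2 : 0 < e / 2 by rewrite divr_gt0.
have [g /(_ _ e2)[g' Sg' g'g] gf] := h _ e2.
exists g' => //; apply: le_lt_trans (nrm_triangle g' g f) _.
by rewrite [ltRHS](splitr e); exact: (ltrD g'g gf).
Qed.

Lemma approximable_subspace S : subspace S -> subspace (approximable S).
Proof.
move=> [S0 SD SZ]; split; first exact: approximableW.
  move=> f g hf hg e e0; have e2 : 0 < e / 2 by rewrite divr_gt0.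
  have [f' Sf' ff'] := hf _ e2; have [g' Sg' gg'] := hg _ e2.
  exists (f' + g'); first exact: SD.
  rewrite opprD addrACA; apply: le_lt_trans (nrmD _ _) _.
  by rewrite [ltRHS](splitr e); exact: (ltrD ff' gg').
move=> l f hf e e0; have k0 : 0 < normc l + 1 by rewrite ltr_wpDl ?normc_ge0.
have [f' Sf' ff'] := hf _ (divr_gt0 e0 k0).
exists (l *: f'); first exact: SZ.
rewrite -scalerBr nrmZ; apply: le_lt_trans (_ : _ <= (normc l + 1) * nrm (f' - f)) _.
  by rewrite ler_wpM2r ?nrm_ge0// lerDl.
by rewrite mulrC -ltr_pdivlMr.
Qed.

Definition mono k : H2 R := iter k (@shift R) one.

Lemma coef_mono k n : coef (mono k) n = (n == k)%:R.
Proof.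
elim: k n => [|k IH] n; first exact: coef_one.
by rewrite /mono iterS coef_shift; case: n => [|n] //=; rewrite IH.
Qed.

Lemma coef0 n : coef (0 : H2 R) n = 0.
Proof. by rewrite -(scale0r (0 : H2 R)) coefZ mul0r. Qed.

Lemma coef_sum (I : Type) (r : seq I) (F : I -> H2 R) n :
  coef (\sum_(i <- r) F i) n = \sum_(i <- r) coef (F i) n.
Proof.
elim: r => [|i r IH]; first by rewrite !big_nil coef0.
by rewrite !big_cons coefD IH.
Qed.

Definition polyH (c : nat -> R[i]) N : H2 R := \sum_(0 <= k < N) c k *: mono k.

Lemma coef_polyH c N n : coef (polyH c N) n = if (n < N)%N then c n else 0.
Proof.
rewrite coef_sum; elim: N => [|N IH]; first by rewrite big_geq.
rewrite big_nat_recr//= IH coefZ coef_mono ltnS.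
by case: ltngtP => // [||->]; rewrite ?mulr0 ?addr0// mulr1 add0r.
Qed.

Opaque mono polyH.

Lemma sum_if_le (F : nat -> R) M N : (forall n, 0 <= F n) ->
  \sum_(0 <= n < M) (if (n < N)%N then F n else 0) <= \sum_(0 <= n < N) F n.
Proof.
move=> F0; have [MN|/ltnW NM] := leqP M N.
  rewrite (big_cat_nat (n := M) (p := N))//=.
  apply: ler_wpDr; first exact: sumr_ge0.
  by apply: ler_sum_nat => n /andP[_ nM]; rewrite (leq_trans nM MN).
rewrite (big_cat_nat (n := N))//= [X in _ + X]big_nat_cond [X in _ + X]big1 ?addr0.
  by apply: ler_sum_nat => n /andP[_ ->].
by move=> n /andP[/andP[Nn _] _]; rewrite ltnNge Nn.
Qed.

Lemma sqr_norm_polyH c N : sqr_norm (polyH c N) <= \sum_(0 <= k < N) normc (c k) ^+ 2.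
Proof.
apply: sqr_norm_le => M.
apply: le_trans (sum_if_le M N (fun n => sqr_ge0 (normc (c n)))).
by apply: ler_sum => n _; rewrite coef_polyH; case: ifP => // _; rewrite normc0 expr0n.
Qed.

Lemma polyH_approx f (e : R) : 0 < e -> exists N, nrm (polyH (coef f) N - f) < e.
Proof.
move=> e0.
have [N _ /(_ _ (leqnn _)) hN] : \forall n \near \oo, sqr_norm f - psum f n < e ^+ 2.
  have := @cvg_sqr_norm _ f => /cvgrPdist_lt /(_ (e ^+ 2) (exprn_gt0 _ e0)).
  by apply: filterS => n; apply: le_lt_trans; exact: ler_norm.
exists N; rewrite -ltr_sqr ?nnegrE ?nrm_ge0 ?(ltW e0)// sqr_nrm.
apply: le_lt_trans hN; apply: sqr_norm_le => M.
apply: (@le_trans _ _ (psum f (maxn M N) - psum f N)); last first.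
  by rewrite lerD2r; exact: psum_le_sqr_norm.
have -> : psum f (maxn M N) - psum f N =
    \sum_(N <= n < maxn M N) normc (coef f n) ^+ 2.
  by rewrite /psum (big_cat_nat (n := N))//= ?leq_maxr// addrAC subrr add0r.
apply: (@le_trans _ _ (\sum_(0 <= n < maxn M N) normc (coef (polyH (coef f) N - f) n) ^+ 2)).
  rewrite [leRHS](big_cat_nat (n := M))//= ?leq_maxl// lerDl.
  by apply: sumr_ge0 => k _; exact: sqr_ge0.
rewrite (big_cat_nat (n := N))//= ?leq_maxr//.
rewrite [X in X + _]big_nat_cond [X in X + _]big1 ?add0r.
  apply: ler_sum_nat => n /andP[Nn _].
  by rewrite coefB coef_polyH ltnNge Nn /= sub0r normcN.
by move=> n /andP[/andP[_ nN] _]; rewrite coefB coef_polyH nN subrr normc0 expr0n.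
Qed.

Lemma approximable_mono S f : subspace S -> (forall k, approximable S (mono k)) ->
  approximable S f.
Proof.
move=> Ssub Smono; apply: approximable_trans => e e0.
have [N hN] := polyH_approx f e0; exists (polyH (coef f) N) => //.
exact: (@subspace_sum (approximable S) (coef f) mono N (approximable_subspace Ssub)).
Qed.

Transparent mono polyH.

(** Modulo a subspace that contains every [z^k (z - al)], the monomial [z^k] is
    congruent to each [al^-j z^(k+j)], hence to their average over [j < N],
    whose norm is [1 / sqrt N]. *)
Lemma approximable_boundary_zero S f (al : R[i]) : subspace S -> normc al = 1 ->
  (forall k, S (mono k.+1 - al *: mono k)) -> approximable S f.
Proof.
move=> Ssub al1 Sal; apply: approximable_mono => // k e e0.
have al0 : al != 0 by rewrite -normc_eq0 al1 oner_eq0.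
have [S0 SD SZ] := Ssub.
have cong j : S (mono k - al ^- j *: mono (k + j)).
  elim: j => [|j IH]; first by rewrite expr0 invr1 scale1r addn0 subrr.
  have -> : mono k - al ^- j.+1 *: mono (k + j.+1) = (mono k - al ^- j *: mono (k + j))
      + - al ^- j.+1 *: (mono (k + j).+1 - al *: mono (k + j)).
    have bal : al ^- j.+1 * al = al ^- j by rewrite exprSr invfM divfK.
    by rewrite addnS scaleNr scalerBr scalerA bal opprB addrA subrK.
  by apply: SD => //; apply: SZ.
(* So that [1 / sqrt N < e]. *)
pose N := (Num.truncn (e ^- 2)).+1.
have N0 : 0 < N%:R :> R by rewrite ltr0n.
have Ne : (N%:R)^-1 < e ^+ 2.
  by rewrite -[ltRHS]invrK ltf_pV2 ?posrE ?invr_gt0 ?exprn_gt0// truncnS_gt.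
pose w : R[i] := (N%:R^-1)%:C.
have wN : w *+ N = 1 by rewrite -rmorphMn /= -mulr_natl mulfV ?gt_eqF.
(* [w = 1 / N]; the average of the congruences above. *)
exists (\sum_(0 <= j < N) w *: (mono k - al ^- j *: mono (k + j))).
  exact: subspace_sum.
rewrite (eq_bigr (fun j => w *: mono k - (w * al ^- j) *: mono (k + j))); last first.
  by move=> j _; rewrite scalerBr scalerA.
rewrite sumrB sumr_const_nat subn0 scalerMnl wN scale1r addrAC subrr sub0r nrmN.
have -> : \sum_(0 <= j < N) (w * al ^- j) *: mono (k + j) =
    iter k (@shift R) (polyH (fun j => w * al ^- j) N).
  apply: H2_ext => z; have iterE m g : iter m (@shift R) g z = pt z ^+ m * g z.
    by elim: m => [|m IH]; rewrite ?mul1r// iterS shiftE IH exprS mulrA.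
  rewrite iterE /polyH !H2_sumE mulr_sumr; apply: eq_bigr => j _.
  by rewrite !H2_scaleE /mono !iterE exprD [RHS]mulrCA !mulrA.
have -> m g : nrm (iter m (@shift R) g) = nrm g.
  by elim: m => [//|m IH]; rewrite iterS nrm_shift.
rewrite -ltr_sqr ?nnegrE ?nrm_ge0 ?(ltW e0)// sqr_nrm.
apply: le_lt_trans (sqr_norm_polyH _ _) _.
have wj j : normc (w * al ^- j) = N%:R^-1.
  by rewrite normcM normcV normcX al1 expr1n invr1 mulr1 normc_real// invr_ge0 ltW.
under eq_bigr do rewrite wj.
rewrite sumr_const_nat subn0 -[ltLHS]mulr_natl [X in _ * X]expr2 mulrA mulfV ?gt_eqF// mul1r.
exact: Ne.
Qed.

Lemma rat_approx (x e : R) : 0 < e -> exists q : rat, `|ratr q - x| < e.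
Proof.
move=> e0; have [|q] := @rat_in_itvoo R (x - e) (x + e); first lra.
by rewrite in_itv /= => /andP[h1 h2]; exists q; rewrite ltr_norml; apply/andP; split; lra.
Qed.

Definition ratC (q : rat * rat) : R[i] := ratr q.1 +i* ratr q.2.

Lemma ratC_approx (x : R[i]) (e : R) : 0 < e -> exists q, normc (ratC q - x) < e.
Proof.
move=> e0; have e2 : 0 < e / 2 by rewrite divr_gt0.
have [p hp] := rat_approx (Re x) e2; have [q hq] := rat_approx (Im x) e2.
exists (p, q); apply: le_lt_trans (normc_le_ReIm _) _.
by rewrite !raddfB /= [ltRHS](splitr e); exact: (ltrD hp hq).
Qed.

(** Separability, with a tolerance attached to each point so that every target
    is met with arbitrarily small tolerance. *)
Lemma H2_separable : exists (P : nat -> H2 R) (tol : nat -> R),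
  (forall j, 0 < tol j) /\
  forall f (e : R), 0 < e -> exists2 j, nrm (P j - f) < e & tol j < e.
Proof.
pose P0 (s : seq (rat * rat)) := polyH (fun n => ratC (nth (0, 0) s n)) (size s).
pose dec j : seq (rat * rat) * nat := odflt ([::], 0%N) (unpickle j).
exists (fun j => P0 (dec j).1), (fun j => (dec j).2.+1%:R^-1); split.
  by move=> j; rewrite invr_gt0 ltr0n.
move=> f e e0; have e2 : 0 < e / 2 by rewrite divr_gt0.
have [N hN] := polyH_approx f e2.
have d0 : 0 < e / 2 / N.+1%:R by rewrite divr_gt0.
have /choice[q hq] := fun n => ratC_approx (coef f n) d0.
pose s := mkseq q N; pose m := Num.truncn (e^-1).
exists (pickle (s, m)); rewrite /dec pickleK /=; last first.
  by rewrite -[ltRHS]invrK ltf_pV2 ?posrE ?invr_gt0// truncnS_gt.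
apply: le_lt_trans (nrm_triangle _ (polyH (coef f) N) _) _.
rewrite [ltRHS](splitr e); apply: (ltrD _ hN).
have -> : P0 s - polyH (coef f) N = \sum_(0 <= n < N) (ratC (q n) - coef f n) *: mono n.
  rewrite /P0 /polyH size_mkseq -sumrB; apply: eq_big_nat => n /andP[_ nN].
  by rewrite nth_mkseq// -scalerBl.
have mono1 n : nrm (mono n) <= 1.
  by elim: n => [|n IH]; [exact: nrm_one_le1|rewrite /mono iterS nrm_shift].
apply: le_lt_trans (nrm_sum _ _) _.
apply: le_lt_trans (_ : _ <= \sum_(0 <= n < N) (e / 2 / N.+1%:R)) _.
  apply: ler_sum => n _; rewrite nrmZ -[leRHS]mulr1.
  by rewrite ler_pM ?normc_ge0 ?nrm_ge0 ?mono1// ltW.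
rewrite sumr_const_nat subn0 -[ltLHS]mulr_natr mulrAC ltr_pdivrMr// ltr_pM2l// ltr_nat.
exact: ltnSn.
Qed.

End approximation.

(** * A hypercyclicity criterion *)

Section criterion.
Context {R : realType}.
Implicit Types (f g p : H2 R).

Lemma half_lt (d : R) : 0 < d -> d / 2 < d.
Proof. by move=> d0; lra. Qed.

Lemma nested_radii (a x y r r' r'' : R) :
  a <= x + y -> x + r'' <= r' -> y + r' <= r -> a + r'' <= r.
Proof. by move=> *; lra. Qed.

Lemma cvg0_lt (x : nat -> R) (e : R) : (forall n, 0 <= x n) ->
  x @ \oo --> (0 : R) -> 0 < e -> exists N, forall n, (N <= n)%N -> x n < e.
Proof.
move=> x0 /cvgrPdist_lt h e0; have [N _ hN] := h e e0; exists N => n Nn.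
by have := hN n Nn; rewrite sub0r normrN ger0_norm.
Qed.

Variable T : H2 R -> H2 R.

Definition iter_continuous := forall n f (e : R), 0 < e ->
  exists2 d : R, 0 < d &
    forall g, nrm (g - f) < d -> nrm (iter n T g - iter n T f) < e.

Definition topologically_transitive := forall f p (e : R), 0 < e ->
  exists2 g, nrm (g - f) < e & exists n, nrm (iter n T g - p) < e.

(** Birkhoff's transitivity theorem, by nested closed balls, the [j]-th one being
    sent by some iterate of [T] close to the [j]-th target of a dense list. *)
Theorem transitive_hypercyclic :
  iter_continuous -> topologically_transitive -> hypercyclic T.
Proof.
move=> Tc Tt; have [P [tol [tol0 PD]]] := H2_separable (R := R).
(* A ball is a pair of a centre and a radius. *)
pose good j (b b' : H2 R * R) := [/\ 0 < b'.2, b'.2 <= b.2 / 2,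
  nrm (b'.1 - b.1) + b'.2 <= b.2 & exists n, forall g, nrm (g - b'.1) <= b'.2 ->
    nrm (iter n T g - P j) < tol j].
have /choice[next hnext] : forall jb : nat * (H2 R * R), exists b',
    0 < jb.2.2 -> good jb.1 jb.2 b'.
  move=> [j [f r]] /=; have [r0|r0] := ltP 0 r; last by exists (f, r).
  have r2 : 0 < r / 2 by rewrite divr_gt0.
  have t2 : 0 < tol j / 2 by rewrite divr_gt0.
  have m0 : 0 < Num.min (r / 2) (tol j / 2) by rewrite lt_min r2.
  have [g gm [n hn]] := Tt f (P j) _ m0.
  have gf : nrm (g - f) < r / 2 by apply: lt_le_trans gm _; rewrite ge_min lexx.
  have gP : nrm (iter n T g - P j) < tol j / 2.
    by apply: lt_le_trans hn _; rewrite ge_min lexx orbT.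
  have [d d0 hd] := Tc n g _ t2.
  have d2 : 0 < d / 2 by rewrite divr_gt0.
  exists (g, Num.min (r / 2) (d / 2)) => _; split => /=.
  - by rewrite lt_min r2.
  - by rewrite ge_min lexx.
  - rewrite [leRHS](splitr r); apply: (lerD (ltW gf)).
    by rewrite ge_min lexx.
  - exists n => h; rewrite le_min => /andP[_ hg].
    apply: le_lt_trans (nrm_triangle _ (iter n T g) _) _.
    rewrite [ltRHS](splitr (tol j)); apply: (ltrD _ gP); apply: hd.
    exact: le_lt_trans hg (half_lt d0).
pose fix B j : H2 R * R := if j is k.+1 then next (k, B k) else (0, 1).
have B0 j : 0 < (B j).2.
  by elim: j => [|j IH] /=; [exact: ltr01|have [] := hnext (j, B j) IH].
have Bgood j : good j (B j) (B j.+1) by exact: (hnext (j, B j) (B0 j)).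
have Bsmall j : (B j).2 <= 2^-1 ^+ j.
  elim: j => [|j IH]; first by rewrite expr0.
  have [_ h _ _] := Bgood j; apply: le_trans h _.
  by rewrite exprSr ler_pM2r ?invr_gt0.
have lim0 : (fun j => (B j).2) @ \oo --> (0 : R).
  apply: (@squeeze_cvgr _ _ _ _ (fun=> 0) (fun j => 2^-1 ^+ j)).
  - by apply: nearW => j; rewrite (ltW (B0 j)) Bsmall.
  - exact: cvg_cst.
  - by apply: cvg_expr; rewrite ger0_norm ?invr_ge0 ?ler0n//; lra.
have nested k m : (k <= m)%N -> nrm ((B m).1 - (B k).1) + (B m).2 <= (B k).2.
  elim: m => [|m IH]; first by rewrite leqn0 => /eqP ->; rewrite subrr nrm0 add0r.
  rewrite leq_eqVlt => /predU1P[->|]; first by rewrite subrr nrm0 add0r.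
  rewrite ltnS => /IH h; have [_ _ h' _] := Bgood m.
  exact: (nested_radii (nrm_triangle (B m.+1).1 (B m).1 (B k).1) h' h).
have [|f hf] := H2_nested_limit (F := fun j => (B j).1) lim0.
  move=> k m km; apply: le_trans (nested k m km).
  by rewrite lerDl ltW.
exists f; apply/denseP => g e e0.
have [j Pg tole] := PD g (e / 2) (divr_gt0 e0 (ltr0Sn _ _)).
have [_ _ _ [n hn]] := Bgood j.
exists (iter n T f); first by exists n.
apply: le_lt_trans (nrm_triangle _ (P j) _) _.
rewrite [ltRHS](splitr e); apply: (ltrD _ Pg).
exact: (lt_trans (hn f (hf j.+1)) tole).
Qed.

Hypothesis TD : forall n f g, iter n T (f + g) = iter n T f + iter n T g.
Hypothesis TZ : forall n (l : R[i]) f, iter n T (l *: f) = l *: iter n T f.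

Definition orbit_null f := (fun n => nrm (iter n T f)) @ \oo --> (0 : R).

Definition backward_null f := exists2 u : nat -> H2 R,
  (fun n => nrm (u n)) @ \oo --> (0 : R) & forall n, iter n T (u n) = f.

Lemma nrm_cvg0D (u v : nat -> H2 R) :
  (fun n => nrm (u n)) @ \oo --> (0 : R) -> (fun n => nrm (v n)) @ \oo --> (0 : R) ->
  (fun n => nrm (u n + v n)) @ \oo --> (0 : R).
Proof.
move=> hu hv.
apply: (@squeeze_cvgr _ _ _ _ (fun=> 0) (fun n => nrm (u n) + nrm (v n))).
- by apply: nearW => n; rewrite nrm_ge0 nrmD.
- exact: cvg_cst.
- suff : (fun n => nrm (u n) + nrm (v n)) @ \oo --> (0 + 0 : R) by rewrite addr0.
  exact: (cvgD hu hv).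
Qed.

Lemma nrm_cvg0Z (l : R[i]) (u : nat -> H2 R) :
  (fun n => nrm (u n)) @ \oo --> (0 : R) ->
  (fun n => nrm (l *: u n)) @ \oo --> (0 : R).
Proof.
move=> hu; under eq_fun do rewrite nrmZ.
suff : (fun n => normc l * nrm (u n)) @ \oo --> normc l * 0 by rewrite mulr0.
by apply: cvgM; [exact: cvg_cst|exact: hu].
Qed.

Lemma iter_zero n : iter n T 0 = 0.
Proof. by have := TZ n 0 0; rewrite !scale0r. Qed.

(** Being subspaces, the two sets of the criterion are dense as soon as they
    contain a few explicit functions. *)
Lemma orbit_null_subspace : subspace orbit_null.
Proof.
split.
- rewrite /orbit_null; under eq_fun do rewrite iter_zero nrm0.
  exact: cvg_cst.
- move=> f g hf hg; rewrite /orbit_null; under eq_fun do rewrite TD.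
  exact: (@nrm_cvg0D _ _ hf hg).
- move=> l f hf; rewrite /orbit_null; under eq_fun do rewrite TZ.
  exact: (@nrm_cvg0Z l _ hf).
Qed.

Lemma backward_null_subspace : subspace backward_null.
Proof.
split.
- exists (fun=> 0) => [|n]; last exact: iter_zero.
  under eq_fun do rewrite nrm0; exact: cvg_cst.
- move=> f g [u u0 uf] [v v0 vg]; exists (fun n => u n + v n).
    exact: (@nrm_cvg0D _ _ u0 v0).
  by move=> n; rewrite TD uf vg.
- move=> l f [u u0 uf]; exists (fun n => l *: u n); first exact: (@nrm_cvg0Z l _ u0).
  by move=> n; rewrite TZ uf.
Qed.

(** The Kitai--Gethner--Shapiro criterion: if [T^n x] and [u n] are small and
    [T^n (u n) = y], then [x + u n] is close to [x] and [T^n] moves it close to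
    [y]. *)
Theorem hypercyclicity_criterion : iter_continuous ->
  (forall f, approximable orbit_null f) -> (forall f, approximable backward_null f) ->
  hypercyclic T.
Proof.
move=> Tc hX hY; apply: transitive_hypercyclic => // f p e e0.
have e2 : 0 < e / 2 by rewrite divr_gt0.
have [x x0 xf] := hX f _ e2; have [y [u u0 uy] yp] := hY p _ e2.
have [N1 hN1] := cvg0_lt (fun n => nrm_ge0 (iter n T x)) x0 e2.
have [N2 hN2] := cvg0_lt (fun n => nrm_ge0 (u n)) u0 e2.
pose n := maxn N1 N2.
have hn1 := hN1 n (leq_maxl _ _); have hn2 := hN2 n (leq_maxr _ _).
exists (x + u n).
  rewrite addrAC; apply: le_lt_trans (nrmD _ _) _.
  by rewrite [ltRHS](splitr e); exact: (ltrD xf hn2).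
exists n; rewrite TD uy -addrA; apply: le_lt_trans (nrmD _ _) _.
by rewrite [ltRHS](splitr e); exact: (ltrD hn1 yp).
Qed.

End criterion.

(** * Dynamics of composition operators *)

Section dynamics.
Context {R : realType}.
Implicit Types (f g h : H2 R) (phi psi chi : disk R -> disk R).

Local Notation C := composition_operator.
Local Notation disk0 := (@disk0 R).

Lemma linear_fractional_id : linear_fractional (@id (disk R)).
Proof.
apply: (@linear_fractional_intro _ _ 1 0 0 1).
- by rewrite mulr1 mulr0 subr0 oner_eq0.
- by move=> z; rewrite mul0r add0r oner_eq0.
- by move=> z; rewrite mul1r mul0r addr0 add0r divr1.
Qed.

Lemma linear_fractional_comp phi psi :
  linear_fractional phi -> linear_fractional psi -> linear_fractional (phi \o psi).
Proof.
move=> /linear_fractionalP[a [b [c [d [det np hphi]]]]].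
move=> /linear_fractionalP[a' [b' [c' [d' [det' np' hpsi]]]]].
have den z : (c * a' + d * c') * pt z + (c * b' + d * d') =
    (c * pt (psi z) + d) * (c' * pt z + d').
  by rewrite hpsi; field; exact: np'.
have num z : (a * a' + b * c') * pt z + (a * b' + b * d') =
    (a * pt (psi z) + b) * (c' * pt z + d').
  by rewrite hpsi; field; exact: np'.
apply: (@linear_fractional_intro _ _ (a * a' + b * c') (a * b' + b * d')
  (c * a' + d * c') (c * b' + d * d')).
- rewrite (_ : _ - _ = (a * d - b * c) * (a' * d' - b' * c')); last by ring.
  by rewrite mulf_neq0.
- by move=> z; rewrite den mulf_neq0.
- by move=> z; rewrite num den /= hphi -mulf_div divff ?mulr1.
Qed.

Lemma linear_fractional_iter phi n :
  linear_fractional phi -> linear_fractional (iter n phi).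
Proof.
move=> hphi; elim: n => [|n IH]; first exact: linear_fractional_id.
exact: linear_fractional_comp.
Qed.

Lemma iter_composition_operator phi n f : linear_fractional phi ->
  iter n (C phi) f = C (iter n phi) f.
Proof.
move=> hphi; have hn m := linear_fractional_iter m hphi.
elim: n => [|n IH]; apply: H2_ext => z.
  by rewrite (composition_operatorE (hn 0%N)).
by rewrite iterS IH !composition_operatorE//= -iterSr.
Qed.

Section symbol.
Variable chi : disk R -> disk R.
Hypothesis hchi : linear_fractional chi.

Lemma composition_operatorD f g : C chi (f + g) = C chi f + C chi g.
Proof. by apply: H2_ext => z; rewrite H2_addE !composition_operatorE. Qed.

Lemma composition_operatorZ (l : R[i]) f : C chi (l *: f) = l *: C chi f.
Proof. by apply: H2_ext => z; rewrite H2_scaleE !composition_operatorE. Qed.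

Lemma composition_operatorB f g : C chi (f - g) = C chi f - C chi g.
Proof. by rewrite composition_operatorD -scaleN1r composition_operatorZ scaleN1r. Qed.

Lemma composition_operator_one : C chi one = one.
Proof. by apply: H2_ext => z; rewrite composition_operatorE. Qed.

Lemma nrm_composition_shift f : nrm (C chi (shift f)) <= nrm (C chi f).
Proof.
have [g gE gN] := contractive_multiplier (C chi f) hchi.
have -> // : C chi (shift f) = g.
by apply: H2_ext => z; rewrite gE !composition_operatorE// shiftE.
Qed.

(** For [k = 0] the function is [chi - al]; replacing the constant term of [chi]
    gives [|chi - al|^2 = |chi|^2 - |chi 0|^2 + |chi 0 - al|^2], where
    [|chi| <= 1]. Each further factor [chi] is a contraction. *)
Lemma nrm_composition_boundary_zero (al : R[i]) k : normc al = 1 ->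
  nrm (C chi (mono k.+1 - al *: mono k)) <=
  Num.sqrt (4 * normc (pt (chi disk0) - al)).
Proof.
move=> al1; elim: k => [|k IH]; last first.
  apply: le_trans IH.
  have -> : mono k.+2 - al *: mono k.+1 = shift (mono k.+1 - al *: mono k).
    apply: H2_ext => z; rewrite shiftE !H2_addE !H2_oppE !H2_scaleE.
    by rewrite /mono !iterS !shiftE; ring.
  exact: nrm_composition_shift.
rewrite -nrm_le ?sqrtr_ge0// sqr_sqrtr; last by rewrite mulr_ge0 ?normc_ge0.
have m1 : C chi (mono 1) = C chi (shift one) by [].
have e0 : coef (C chi (mono 1)) 0 = pt (chi disk0).
  by rewrite -eval_disk0 m1 composition_operatorE// shiftE mulr1.
have n1 : sqr_norm (C chi (mono 1)) <= 1 ^+ 2.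
  rewrite nrm_le// m1; apply: le_trans (nrm_composition_shift _) _.
  by rewrite composition_operator_one nrm_one_le1.
have -> : C chi (mono 1 - al *: mono 0) = C chi (mono 1) + (- al) *: one.
  by rewrite composition_operatorB composition_operatorZ composition_operator_one scaleNr.
rewrite sqr_norm_addc e0.
have h1 : normc (pt (chi disk0)) < 1 := disk_normc _.
have h2 : 1 - normc (pt (chi disk0)) <= normc (pt (chi disk0) - al).
  by rewrite -al1 normcBC; exact: normcB_ge.
have h3 : normc (pt (chi disk0) - al) <= normc (pt (chi disk0)) + 1.
  by rewrite -al1 -[normc al]normcN; exact: normcD.
move: (sqr_norm _) (normc _) (normc (pt (chi disk0) - al)) n1 (normc_ge0 (pt (chi disk0)))  h1 h2 h3.
by move=> s x y; rewrite expr1n; nra.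
Qed.

End symbol.

(** Iterates of the symbol that converge to a boundary point [al] kill the
    functions that vanish at [al]. *)
Lemma composition_boundary_zero_cvg (chi : nat -> disk R -> disk R) (al : R[i]) k :
  (forall n, linear_fractional (chi n)) -> normc al = 1 ->
  (fun n => normc (pt (chi n disk0) - al)) @ \oo --> (0 : R) ->
  (fun n => nrm (C (chi n) (mono k.+1 - al *: mono k))) @ \oo --> (0 : R).
Proof.
move=> hchi al1 h.
apply: (@squeeze_cvgr _ _ _ _ (fun=> 0)
  (fun n => Num.sqrt (4 * normc (pt (chi n disk0) - al)))).
- by apply: nearW => n; rewrite nrm_ge0 nrm_composition_boundary_zero.
- exact: cvg_cst.
- suff : (fun n => Num.sqrt (4 * normc (pt (chi n disk0) - al))) @ \oo -->
      Num.sqrt (4 * 0 : R) by rewrite mulr0 sqrtr0.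
  apply: (@continuous_cvg _ _ _ _ _ _ (@Num.sqrt R)); first exact: sqrt_continuous.
  by apply: cvgM; [exact: cvg_cst|exact: h].
Qed.

Lemma composition_iter_continuous phi : linear_fractional phi ->
  iter_continuous (C phi).
Proof.
move=> hphi n f e e0.
have [K K0 hK] := composition_operator_bound (linear_fractional_iter n hphi).
exists (e / K); first by rewrite divr_gt0.
move=> g gf; rewrite !iter_composition_operator//.
rewrite -composition_operatorB; last exact: linear_fractional_iter.
by apply: le_lt_trans (hK _) _; rewrite mulrC -ltr_pdivlMr.
Qed.

(** [phi^n] carries the base point to [al], and [psin n] plays the part of
    [psi \o phi^-n], where [phi^-n] need not preserve the disk. Functions that
    vanish at [al] have null orbits; those of the form [f \o psi], with [f]
    vanishing at [be], have the null backward orbits [f \o psin n]. *)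
Theorem hypercyclic_of_boundary_limits phi psi (psin : nat -> disk R -> disk R)
    (al be : R[i]) :
  linear_fractional phi -> linear_fractional psi ->
  (forall n, linear_fractional (psin n)) ->
  normc al = 1 -> normc be = 1 ->
  (fun n => normc (pt (iter n phi disk0) - al)) @ \oo --> (0 : R) ->
  (fun n => normc (pt (psin n disk0) - be)) @ \oo --> (0 : R) ->
  (forall n z, psin n (iter n phi z) = psi z) ->
  (forall f, approximable (range (C psi)) f) ->
  hypercyclic (C phi).
Proof.
move=> hphi hpsi hpsin al1 be1 cal cbe rel rdense.
have hit n := linear_fractional_iter n hphi.
have TD n f g : iter n (C phi) (f + g) = iter n (C phi) f + iter n (C phi) g.
  by rewrite !iter_composition_operator// composition_operatorD.
have TZ n l f : iter n (C phi) (l *: f) = l *: iter n (C phi) f.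
  by rewrite !iter_composition_operator// composition_operatorZ.
apply: (hypercyclicity_criterion TD).
- exact: composition_iter_continuous.
- move=> f; apply: (approximable_boundary_zero f (orbit_null_subspace TD TZ) al1) => k.
  rewrite /orbit_null; under eq_fun do rewrite iter_composition_operator//.
  exact: (composition_boundary_zero_cvg (chi := fun n => iter n phi)).
pose Y := [set f | backward_null (C phi) (C psi f)].
have [B0 BD BZ] := backward_null_subspace TD TZ.
have Ysub : subspace Y.
  split.
  - by rewrite /Y /= -(scale0r (0 : H2 R)) composition_operatorZ// scale0r.
  - by move=> f g Yf Yg; rewrite /Y /= composition_operatorD//; exact: BD.
  - by move=> l f Yf; rewrite /Y /= composition_operatorZ//; exact: BZ.
have Ydense f : approximable Y f.
  apply: (approximable_boundary_zero f Ysub be1) => k.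
  exists (fun n => C (psin n) (mono k.+1 - be *: mono k)).
    exact: composition_boundary_zero_cvg.
  move=> n; rewrite iter_composition_operator//; apply: H2_ext => z.
  by rewrite !composition_operatorE// rel.
move=> f; apply: approximable_trans => e e0.
have [_ [g _ <-] gf] := rdense f e e0.
exists (C psi g) => // d d0.
have [K K0 hK] := composition_operator_bound hpsi.
have [g' Yg' g'g] := Ydense g (d / K) (divr_gt0 d0 K0).
exists (C psi g') => //; rewrite -composition_operatorB//.
by apply: le_lt_trans (hK _) _; rewrite mulrC -ltr_pdivlMr.
Qed.

Lemma range_composition_subspace psi : linear_fractional psi -> subspace (range (C psi)).
Proof.
move=> hpsi; split.
- by exists 0 => //; rewrite -(scale0r (0 : H2 R)) composition_operatorZ// !scale0r.
- by move=> _ _ [f _ <-] [g _ <-]; exists (f + g) => //; rewrite composition_operatorD.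
- by move=> l _ [f _ <-]; exists (l *: f) => //; rewrite composition_operatorZ.
Qed.

(** If [z] is a linear fractional function of [psi] with its pole off the
    closed disk, a geometric series approximates [z f] by elements of the
    range whenever [f] is in it. *)
Lemma dense_range_of_inverse psi (p q r t : R[i]) : linear_fractional psi ->
  normc r < normc t ->
  (forall z, pt z * (r * pt (psi z) + t) = p * pt (psi z) + q) ->
  forall f, approximable (range (C psi)) f.
Proof.
move=> hpsi rt inv f.
have sub := range_composition_subspace hpsi.
have t0 : t != 0 by rewrite -normc_gt0; apply: le_lt_trans rt; exact: normc_ge0.
pose w := - r / t.
have w1 : normc w < 1 by rewrite normcM normcN normcV ltr_pdivrMr ?mul1r// normc_gt0.
have step0 g : approximable (range (C psi)) (shift (C psi g)).
  move=> e e0.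
  have [N hN] : exists N, normc w ^+ N * nrm (C psi g) < e.
    have lim : (fun N => normc w ^+ N * nrm (C psi g)) @ \oo --> 0 * nrm (C psi g).
      apply: cvgM; last exact: cvg_cst.
      by apply: cvg_expr; rewrite ger0_norm ?normc_ge0.
    rewrite mul0r in lim.
    have nn n : 0 <= normc w ^+ n * nrm (C psi g).
      by rewrite mulr_ge0 ?exprn_ge0 ?normc_ge0 ?nrm_ge0.
    by have [N hN] := cvg0_lt nn lim e0; exists N; exact: hN.
  (* The partial sums of the geometric series of [1 / (t + r psi)]. *)
  pose G : H2 R := \sum_(0 <= k < N) (w ^+ k / t) *: iter k (@shift R) g.
  exists (C psi (affine_mul p q G)); first by exists (affine_mul p q G).
  have iterE m h z : iter m (@shift R) h z = pt z ^+ m * h z.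
    by elim: m => [|m IH]; rewrite ?mul1r// iterS shiftE IH exprS mulrA.
  have -> : C psi (affine_mul p q G) - shift (C psi g) =
      (- w ^+ N) *: shift (C psi (iter N (@shift R) g)).
    apply: H2_ext => z.
    rewrite H2_addE H2_oppE H2_scaleE !shiftE !composition_operatorE// affine_mulE.
    rewrite iterE -inv H2_sumE.
    set u := pt (psi z); set v := g (psi z).
    have -> : \sum_(0 <= k < N) ((w ^+ k / t) *: iter k (@shift R) g) (psi z) =
        (\sum_(0 <= k < N) (w * u) ^+ k) / t * v.
      rewrite mulr_suml mulr_suml; apply: eq_bigr => k _.
      by rewrite H2_scaleE iterE -/u -/v (exprMn _ w u); ring.
    have geo : (1 - w * u) * \sum_(0 <= k < N) (w * u) ^+ k = 1 - (w * u) ^+ N.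
      by rewrite big_mkord -opprB mulNr -subrX1 opprB.
    have -> : r * u + t = t * (1 - w * u) by rewrite /w; field.
    have -> : pt z * (t * (1 - w * u)) * ((\sum_(0 <= k < N) (w * u) ^+ k) / t * v) =
        pt z * ((1 - w * u) * \sum_(0 <= k < N) (w * u) ^+ k) * v by field.
    by rewrite geo (exprMn _ w u); ring.
  rewrite nrmZ normcN normcX; apply: le_lt_trans hN.
  apply: ler_wpM2l; first by rewrite exprn_ge0// normc_ge0.
  rewrite nrm_shift; elim: {G} N => [//|N IH]; rewrite iterS.
  exact: le_trans (nrm_composition_shift hpsi _) IH.
have step h : approximable (range (C psi)) h -> approximable (range (C psi)) (shift h).
  move=> hh; apply: approximable_trans => e e0.
  have [_ [g _ <-] gh] := hh e e0; exists (shift (C psi g)); first exact: step0.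
  have -> : shift (C psi g) - shift h = shift (C psi g - h).
    by apply: H2_ext => z; rewrite !(H2_addE, H2_oppE, shiftE) mulrBr.
  by rewrite nrm_shift.
apply: approximable_mono => //; elim=> [|k IH]; last exact: step.
by apply: approximableW; exists one => //; exact: composition_operator_one.
Qed.

Lemma dense_range_iter psi n : linear_fractional psi ->
  (forall f, approximable (range (C psi)) f) ->
  forall f, approximable (range (C (iter n psi))) f.
Proof.
move=> hpsi hd; have hit k := linear_fractional_iter k hpsi.
elim: n => [|n IH] f.
  by apply: approximableW; exists f => //; apply: H2_ext => z; rewrite composition_operatorE.
apply: approximable_trans => e e0.
have [_ [g _ <-] gf] := hd f e e0; exists (C psi g) => // d d0.
have [K K0 hK] := composition_operator_bound hpsi.
have [_ [h _ <-] hg] := IH g (d / K) (divr_gt0 d0 K0).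
exists (C (iter n.+1 psi) h); first by exists h.
have -> : C (iter n.+1 psi) h = C psi (C (iter n psi) h).
  by apply: H2_ext => z; rewrite !composition_operatorE// iterSr.
rewrite -composition_operatorB//.
by apply: le_lt_trans (hK _) _; rewrite mulrC -ltr_pdivlMr.
Qed.

End dynamics.

(** * Obstructions to weak hypercyclicity *)

Section weak_topology.
Context {K : numFieldType} {X : normedModType K}.

(** Continuous functionals are weakly continuous by definition of the weak
    topology, so that preimages of open sets are weakly open. *)
Lemma weak_dense_functional (S : set X) (l : {linear X -> K^o}) (O : set K^o) (g : X) :
  continuous l -> @dense (weak X) S -> open O -> O (l g) ->
  exists2 x, S x & O (l x).
Proof.
move=> lc dS oO Og; pose li : continuous_functional X := exist _ l lc.
have oP : @open (weak X) (l @^-1` O).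
  rewrite openE => x Ox.
  have /cvg_sup/(_ li) h : (nbhs (x : weak X)) --> (x : weak X) by exact: cvg_id.
  apply: h; apply: open_nbhs_nbhs; split => //.
  by exists O.
by have [x [Ox Sx]] := dS _ (ex_intro _ g Og) oP; exists x.
Qed.

(** Continuity of the functionals makes every weakly open set norm open. *)
Lemma dense_weak (S : set X) : dense S -> @dense (weak X) S.
Proof.
move=> dS O [x Ox] oO.
have oX : @open X O.
  rewrite openE => y Oy.
  have h : nbhs (y : X) --> (y : weak X).
    apply/cvg_sup => -[l lc] A; rewrite nbhs_simpl.
    move=> [B [[C oC <-] Cy] BA]; apply: filterS BA _ .
    by apply: (lc y); apply: open_nbhs_nbhs.
  apply: h; exact: open_nbhs_nbhs.
by apply: dS => //; exists x.
Qed.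

Lemma hypercyclic_weakly_hypercyclic (T : X -> X) :
  hypercyclic T -> weakly_hypercyclic T.
Proof. by move=> [x dx]; exists x; exact: dense_weak. Qed.

End weak_topology.

Section obstructions.
Context {R : realType}.
Implicit Types (f g h : H2 R) (phi : disk R -> disk R).

Local Notation C := composition_operator.

(** Covers both functionals used below, a point evaluation and the difference
    of two. *)
Definition eval2 (a b : R[i]) (z w : disk R) (f : H2 R) : R[i]^o := a * f z + b * f w.

Lemma eval2_linear a b z w : linear (eval2 a b z w).
Proof.
by move=> l f g; rewrite /eval2 !H2_addE !H2_scaleE /GRing.scale /=; ring.
Qed.

HB.instance Definition _ a b z w :=
  GRing.isLinear.Build R[i] (H2 R) R[i]^o *:%R (eval2 a b z w) (eval2_linear a b z w).

Lemma eval2_continuous a b z w : continuous (eval2 a b z w).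
Proof.
apply: bounded_linear_continuous; apply/linear_boundedP.
pose M := normc a / (1 - normc (pt z)) + normc b / (1 - normc (pt w)).
exists (M%:C); split; first by rewrite complex_real.
move=> r Mr f; apply: le_trans (_ : _ <= M%:C * `|f|) _; last first.
  by rewrite ler_wpM2r// ltW.
rewrite normcE nrmE -rmorphM lecR /eval2; apply: le_trans (normcD _ _) _.
rewrite !normcM mulrDl; apply: lerD.
  by rewrite -mulrA ler_wpM2l ?normc_ge0// mulrC; exact: eval_le.
by rewrite -mulrA ler_wpM2l ?normc_ge0// mulrC; exact: eval_le.
Qed.

Lemma weak_dense_eval2 (S : set (H2 R)) a b z w g : @dense (weak (H2 R)) S ->
  exists2 x, S x & normc (eval2 a b z w x - eval2 a b z w g) < 1.
Proof.
move=> dS.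
have Og : (interior (ball (eval2 a b z w g) 1)) (eval2 a b z w g) by apply: nbhsx_ballx.
have [x Sx /interior_subset Ox] :=
  weak_dense_functional (@eval2_continuous a b z w) dS (open_interior _) Og.
exists x => //; move: Ox; rewrite -ball_normE /ball_ /= normcE normcBC.
by rewrite -(rmorph1 (real_complex R)) ltcR.
Qed.

(** Every function in the orbit takes the same value at a fixed point. *)
Lemma fixed_point_not_weakly_hypercyclic phi p : linear_fractional phi ->
  phi p = p -> ~ weakly_hypercyclic (C phi).
Proof.
move=> hphi fp [f df].
have [_ [n _ <-]] := weak_dense_eval2 1 0 p p ((f p + 2) *: one) df.
rewrite /eval2 !mul1r !mul0r !addr0 H2_scaleE mulr1 iter_composition_operator//.
rewrite composition_operatorE; last exact: linear_fractional_iter.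
have -> : iter n phi p = p by elim: n => //= n ->.
rewrite opprD addrA subrr sub0r normcN.
have -> : (2 : R[i]) = (2 : R)%:C by rewrite rmorph_nat.
by rewrite normc_real// ltNge => /negP[]; lra.
Qed.

(** The functional [f z - f w] is onto, but bounded along each orbit. *)
Lemma bounded_difference_not_weakly_hypercyclic phi z w : linear_fractional phi ->
  pt z != pt w ->
  (forall f, exists M : R, forall n,
    normc (f (iter n phi z) - f (iter n phi w)) <= M) ->
  ~ weakly_hypercyclic (C phi).
Proof.
move=> hphi zw bnd [f df]; have [M hM] := bnd f.
have M0 : 0 <= M by apply: le_trans (hM 0%N); exact: normc_ge0.
have zw0 : pt z - pt w != 0 by rewrite subr_eq0.
have [_ [n _ <-]] := weak_dense_eval2 1 (-1) z w (((M + 1)%:C / (pt z - pt w)) *: mono 1) df.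
rewrite /eval2 !mul1r !mulN1r !H2_scaleE iter_composition_operator//.
rewrite !composition_operatorE; do ?exact: linear_fractional_iter.
have m1 (x : disk R) : mono 1 x = pt x by rewrite /mono iterS shiftE; exact: mulr1.
rewrite !m1 -[X in _ - X]mulrBr divfK// => h.
have t := normcB_ge ((M + 1)%:C) (f (iter n phi z) - f (iter n phi w)).
rewrite normcBC in h; have := le_lt_trans t h.
rewrite normc_real ?addr_ge0//; have := hM n; move: (normc _) => x; lra.
Qed.

Lemma sum_power_difference_le (x y : R) N : 0 <= x -> x < 1 -> 0 <= y -> y < 1 ->
  \sum_(0 <= k < N) \sum_(i < k) x ^+ (k.-1 - i) * y ^+ i <= ((1 - x) * (1 - y))^-1.
Proof.
move=> x0 x1 y0 y1.
have x1' : 0 < 1 - x by rewrite subr_gt0.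
have y1' : 0 < 1 - y by rewrite subr_gt0.
elim: N => [|N IH]; first by rewrite big_geq// invr_ge0 mulr_ge0// ltW.
rewrite big_nat_recl// big_ord0 add0r.
have -> : \sum_(0 <= k < N) \sum_(i < k.+1) x ^+ (k.+1.-1 - i) * y ^+ i =
   x * (\sum_(0 <= k < N) \sum_(i < k) x ^+ (k.-1 - i) * y ^+ i) +
   \sum_(0 <= k < N) y ^+ k.
  rewrite mulr_sumr -big_split /=; apply: eq_bigr => k _.
  rewrite big_ord_recr /= subnn expr0 mul1r mulr_sumr; congr (_ + _).
  apply: eq_bigr => i _; rewrite mulrA -exprS; congr (x ^+ _ * _).
  by case: k i => [[]//|k] i /=; rewrite subSn// -ltnS.
apply: le_trans (lerD (ler_wpM2l x0 IH) (sum_geometric_le N y0 y1)) _.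
rewrite invfM; set a := (1 - x)^-1; set b := (1 - y)^-1.
have e : (1 - x) * a = 1 by rewrite mulfV ?gt_eqF.
have eb : x * (a * b) + b = a * b + (1 - (1 - x) * a) * b by ring.
by rewrite eb e subrr mul0r addr0.
Qed.

(** A quantitative form of [|f'| <= |f| / (1 - |z|)^2], from the factorisation
    of [u^k - v^k]. *)
Lemma eval_difference_le f (u v : disk R) :
  normc (f u - f v) <= nrm f *
    (normc (pt u - pt v) / ((1 - normc (pt u)) * (1 - normc (pt v)))).
Proof.
have hu := @cvg_power_series _ f u; have hv := @cvg_power_series _ f v.
apply/ler_addgt0Pr => e e0; have e2 : 0 < e / 2 by rewrite divr_gt0.
have [N1 hN1] := cvg0_lt (fun n => normc_ge0 _) hu e2.
have [N2 hN2] := cvg0_lt (fun n => normc_ge0 _) hv e2.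
pose N := maxn N1 N2.
have {}hu := hN1 N (leq_maxl _ _); have {}hv := hN2 N (leq_maxr _ _).
move: hu hv; set su := \sum_(_ <= _ < _) _; set sv := \sum_(_ <= _ < _) _ => hu hv.
have tri : normc (f u - f v) <= normc (su - sv) + (normc (su - f u) + normc (sv - f v)).
  have -> : f u - f v = (su - sv) - ((su - f u) - (sv - f v)) by ring.
  apply: le_trans (normcD _ _) _; rewrite lerD2l normcN.
  by apply: le_trans (normcD _ _) _; rewrite normcN.
apply: le_trans tri _; apply: lerD; last first.
  by rewrite [leRHS](splitr e); apply: lerD; apply: ltW.
have -> : su - sv = (pt u - pt v) * \sum_(0 <= k < N) coef f k *
    \sum_(i < k) pt u ^+ (k.-1 - i) * pt v ^+ i.
  rewrite /su /sv -sumrB mulr_sumr; apply: eq_bigr => k _.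
  by rewrite -mulrBr subrXX mulrCA.
rewrite normcM [leRHS]mulrCA; apply: ler_wpM2l; first exact: normc_ge0.
apply: le_trans (normc_sum _ _ _) _.
apply: le_trans (_ : _ <= nrm f * \sum_(0 <= k < N)
    \sum_(i < k) normc (pt u) ^+ (k.-1 - i) * normc (pt v) ^+ i) _.
  rewrite mulr_sumr; apply: ler_sum => k _; rewrite normcM.
  apply: ler_pM; rewrite ?normc_ge0 ?coef_le_nrm//.
  rewrite -(big_mkord xpredT (fun i => pt u ^+ (k.-1 - i) * pt v ^+ i)).
  apply: le_trans (normc_sum _ _ _) _; rewrite big_mkord.
  by apply: ler_sum => i _; rewrite normcM !normcX.
apply: ler_wpM2l; first exact: nrm_ge0.
by apply: sum_power_difference_le; rewrite ?normc_ge0 ?disk_normc.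
Qed.

End obstructions.

(** * The half-plane model at a boundary fixed point *)

Section half_plane.
Context {R : realType}.
Implicit Types (phi psi chi : disk R -> disk R) (z : disk R) (w q : R[i]).

Local Notation C := composition_operator.
Local Notation disk0 := (@disk0 R).

Lemma normc_lt_half_plane w : 0 < Re w -> normc (w - 1) < normc (w + 1).
Proof.
move=> w0; rewrite -ltr_sqr ?nnegrE ?normc_ge0// !sqr_normcE.
by case: w w0 => u v /= u0; lra.
Qed.

Lemma normcD1_ge w : Re w + 1 <= normc (w + 1).
Proof.
apply: le_trans (normc_Re _); apply: le_trans (ler_norm _).
by rewrite raddfD.
Qed.

Lemma half_plane_neqN1 w : 0 <= Re w -> w + 1 != 0.
Proof.
move=> w0; rewrite -normc_gt0; apply: lt_le_trans (normcD1_ge w); lra.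
Qed.

Variable al : R[i].
Hypothesis al1 : normc al = 1.

Let al0 : al != 0. Proof. by rewrite -normc_eq0 al1 oner_eq0. Qed.

(** The Cayley transform sending the disk to the right half-plane and the
    boundary point [al] to infinity, and its inverse. *)
Definition cayley z : R[i] := (al + pt z) / (al - pt z).

Definition cayley_inv w : R[i] := al * (w - 1) / (w + 1).

Lemma al_sub_neq0 z : al - pt z != 0.
Proof.
rewrite subr_eq0; apply/eqP => e; have := disk_normc z.
by rewrite -e al1 ltxx.
Qed.

Lemma cayleyD1 z : cayley z + 1 = 2 * al / (al - pt z).
Proof. by rewrite /cayley; field; exact: al_sub_neq0. Qed.

Lemma cayleyK z : cayley_inv (cayley z) = pt z.
Proof.
rewrite /cayley_inv cayleyD1 /cayley; field.
by rewrite al_sub_neq0 al0.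
Qed.

Lemma cayley_inj : injective cayley.
Proof. by move=> z z' e; apply: pt_inj; rewrite -!cayleyK e. Qed.

Lemma disk_of_half_plane w : 0 < Re w -> exists z, cayley z = w.
Proof.
move=> w0; have w1 : w + 1 != 0 by apply: half_plane_neqN1; exact: ltW.
have hw : normc (cayley_inv w) < 1.
  rewrite /cayley_inv !normcM al1 mul1r normcV ltr_pdivrMr ?normc_gt0// mul1r.
  exact: normc_lt_half_plane.
exists (in_disk hw); rewrite /cayley pt_in_disk /cayley_inv.
field; rewrite w1 /=.
rewrite (_ : _ - _ = 2 * al); last by ring.
by rewrite mulf_neq0// pnatr_eq0.
Qed.

(** The distance to the unit circle in half-plane coordinates. *)
Lemma Re_cayley z : Re (cayley z) * normc (al - pt z) ^+ 2 = 1 - normc (pt z) ^+ 2.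
Proof.
have e : cayley z * (al - pt z) = al + pt z by rewrite /cayley divfK// al_sub_neq0.
have key (h x y : R[i]) : h * (x - y) = x + y -> Re h * normc (x - y) ^+ 2 =
    normc x ^+ 2 - normc y ^+ 2.
  move=> hxy.
  have : Re (h * (x - y) * conjc (x - y)) = Re ((x + y) * conjc (x - y)) by rewrite hxy.
  rewrite !sqr_normcE; case: h x y {hxy} => [h h'] [x x'] [y y'] /=.
  by move=> H; apply/eqP; rewrite -subr_eq0; apply/eqP; nra.
by rewrite key// al1 expr1n.
Qed.

Lemma Re_cayley_gt0 z : 0 < Re (cayley z).
Proof.
have h : 0 < normc (al - pt z) ^+ 2 by rewrite exprn_gt0// normc_gt0 al_sub_neq0.
rewrite -(pmulr_lgt0 _ h) Re_cayley subr_gt0.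
by rewrite -(expr1n _ 2) ltr_sqr ?nnegrE ?normc_ge0 ?disk_normc.
Qed.

Lemma cayley_disk0 : cayley disk0 = 1.
Proof. by rewrite /cayley pt_in_disk addr0 subr0 divff. Qed.

(** Affine maps [w -> p w + q] of the half-plane, transported to the disk. *)
Lemma half_plane_affine (p : R) q : 0 < p -> 0 <= Re q ->
  exists2 chi, linear_fractional chi & forall z, cayley (chi z) = p%:C * cayley z + q.
Proof.
move=> p0 q0.
have RePos z : 0 < Re (p%:C * cayley z + q).
  rewrite raddfD /= (_ : Re _ = p * Re (cayley z)); last by case: (cayley z) => u v /=; ring.
  by rewrite ltr_wpDr// mulr_gt0// Re_cayley_gt0.
have /choice[chi hchi] : forall z, exists z', cayley z' = p%:C * cayley z + q.
  by move=> z; exact: disk_of_half_plane.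
exists chi => //.
have pC0 : p%:C != 0 :> R[i] by rewrite eq_complex /= negb_and gt_eqF.
have den z : (p%:C - q - 1) * pt z + al * (p%:C + q + 1) =
    (p%:C * cayley z + q + 1) * (al - pt z).
  by rewrite /cayley; field; exact: al_sub_neq0.
have num z : al * (p%:C - q + 1) * pt z + al ^+ 2 * (p%:C + q - 1) =
    al * (p%:C * cayley z + q - 1) * (al - pt z).
  by rewrite /cayley; field; exact: al_sub_neq0.
apply: (@linear_fractional_intro _ _ (al * (p%:C - q + 1)) (al ^+ 2 * (p%:C + q - 1))
  (p%:C - q - 1) (al * (p%:C + q + 1))).
- rewrite (_ : _ - _ = 4 * p%:C * al ^+ 2); last by ring.
  by rewrite !mulf_neq0// ?expf_neq0// pnatr_eq0.
- move=> z; rewrite den mulf_neq0 ?al_sub_neq0//.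
  by apply: half_plane_neqN1; exact: ltW.
- move=> z; rewrite num den -mulf_div divff ?al_sub_neq0// mulr1.
  by rewrite -cayleyK hchi.
Qed.

Lemma pt_sub_al z : normc (pt z - al) = 2 / normc (cayley z + 1).
Proof.
rewrite cayleyD1 !normcM normcV al1 mulr1 normcBC.
have -> : (2 : R[i]) = (2 : R)%:C by rewrite rmorph_nat.
by rewrite normc_real// invfM invrK mulrA mulfV ?pnatr_eq0// mul1r.
Qed.

Lemma pt_sub_cayley_inv z w : 0 <= Re w ->
  normc (pt z - cayley_inv w) <= 2 * normc (cayley z - w).
Proof.
move=> w0; rewrite -cayleyK; set v := cayley z.
have v1 : v + 1 != 0 by apply: half_plane_neqN1; rewrite ltW// Re_cayley_gt0.
have w1 : w + 1 != 0 by exact: half_plane_neqN1.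
have -> : cayley_inv v - cayley_inv w = 2 * al * (v - w) / ((v + 1) * (w + 1)).
  by rewrite /cayley_inv; field; rewrite v1 w1.
rewrite !normcM normcV normcM al1 mulr1.
have -> : (2 : R[i]) = (2 : R)%:C by rewrite rmorph_nat.
rewrite normc_real// ler_pdivrMr ?mulr_gt0 ?normc_gt0//.
rewrite -[leLHS]mulr1; apply: ler_wpM2l; first by rewrite mulr_ge0 ?normc_ge0.
rewrite -[1]mulr1; apply: ler_pM => //.
  by apply: le_trans (normcD1_ge v); have := Re_cayley_gt0 z; rewrite -/v; lra.
by apply: le_trans (normcD1_ge w); lra.
Qed.

Lemma normc_cayley_inv w : Re w = 0 -> normc (cayley_inv w) = 1.
Proof.
move=> w0; have w1 : w + 1 != 0 by apply: half_plane_neqN1; rewrite w0.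
rewrite !normcM al1 mul1r normcV.
have -> : normc (w - 1) = normc (w + 1).
  apply/eqP; rewrite -(@eqrXn2 _ 2) ?normc_ge0// !sqr_normcE.
  by case: w w0 {w1} => u v /= ->; apply/eqP; ring.
by rewrite mulfV// normc_eq0.
Qed.

(** Translations of the half-plane induce operators of dense range: a short
    translation is invertible up to a pole off the closed disk, and a long one
    is an iterate of a short one. *)
Lemma translation_dense_range psi q : 0 <= Re q ->
  (forall z, cayley (psi z) = cayley z + q) ->
  forall f, approximable (range (C psi)) f.
Proof.
move=> q0 hpsi.
(* The pole of the inverse is off the closed disk when [Re (q / m) < 1]. *)
pose m := (Num.truncn (Re q)).+1.
have m0 : 0 < m%:R :> R by rewrite ltr0n.
pose s := (m%:R^-1 : R)%:C * q.
have Res : Re s = Re q / m%:R by rewrite /s; case: (q) => u v /=; ring.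
have s0 : 0 <= Re s by rewrite Res divr_ge0// ltW.
have s1 : Re s < 1 by rewrite Res ltr_pdivrMr// mul1r truncnS_gt.
have [chi lchi hchi] := half_plane_affine (ltr01) s0.
have -> : psi = iter m chi.
  apply/funext => z; apply: cayley_inj; rewrite hpsi.
  have -> n : cayley (iter n chi z) = cayley z + s *+ n.
    elim: n => [|n IH]; first by rewrite mulr0n addr0.
    by rewrite iterS hchi IH rmorph1 mul1r mulrS -addrA [s *+ n + s]addrC.
  congr (_ + _); rewrite /s -mulrnAl -rmorphMn /= -mulr_natl mulfV ?gt_eqF//.
  by rewrite rmorph1 mul1r.
apply: dense_range_iter => //.
apply: (@dense_range_of_inverse _ _ ((2 + s) * al) (- s * al ^+ 2) s ((2 - s) * al)) => //.
  rewrite [ltRHS]normcM al1 mulr1 -ltr_sqr ?nnegrE ?normc_ge0// !sqr_normcE.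
  by move: s1; case: (s) => u v /=; lra.
move=> z; have := hchi z; rewrite rmorph1 mul1r /cayley => /eqP.
rewrite -subr_eq0 => /eqP e; apply/eqP; rewrite -subr_eq0; apply/eqP.
have -> : pt z * (s * pt (chi z) + (2 - s) * al) - ((2 + s) * al * pt (chi z) + - s * al ^+ 2)
  = - (al - pt z) * (al - pt (chi z)) *
    ((al + pt (chi z)) / (al - pt (chi z)) - ((al + pt z) / (al - pt z) + s)).
  by field; rewrite !al_sub_neq0.
by rewrite e mulr0.
Qed.

Variables (phi : disk R -> disk R) (A : R) (B : R[i]).
Hypothesis lphi : linear_fractional phi.
Hypothesis hphi : forall z, cayley (phi z) = A%:C * cayley z + B.

Lemma half_plane_fixed_point w : 0 < Re w -> A%:C * w + B = w ->
  ~ weakly_hypercyclic (C phi).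
Proof.
move=> /disk_of_half_plane[p <-] e.
apply: (fixed_point_not_weakly_hypercyclic (p := p)) => //.
by apply: cayley_inj; rewrite hphi.
Qed.

Lemma cayley_iter_translation n z : A = 1 -> cayley (iter n phi z) = cayley z + B *+ n.
Proof.
move=> A1; elim: n => [|n IH]; first by rewrite mulr0n addr0.
by rewrite iterS hphi A1 IH rmorph1 mul1r mulrS -addrA [B *+ n + B]addrC.
Qed.

(** [- B / (A - 1)] is the fixed point of [w -> A w + B]. *)
Lemma cayley_iter_dilation n z : A != 1 ->
  cayley (iter n phi z) = (A ^+ n)%:C * (cayley z + B / (A - 1)%:C) - B / (A - 1)%:C.
Proof.
move=> A1; have A1' : (A - 1)%:C != 0 :> R[i] by rewrite fmorph_eq0 subr_eq0.
elim: n => [|n IH]; first by rewrite expr0 rmorph1 mul1r addrK.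
rewrite iterS hphi IH exprS; rewrite rmorphB rmorph1 in A1' *.
by rewrite rmorphM; field.
Qed.

(** In half-plane coordinates the orbits of two points stay at a fixed distance
    while moving off non-tangentially, so their images in the disk get close at
    the rate at which the derivative of a function in [H^2] may grow. *)
Lemma parabolic_nonautomorphism : A = 1 -> 0 < Re B -> ~ weakly_hypercyclic (C phi).
Proof.
move=> A1 ReB.
have half : normc (2^-1 : R)%:C < 1 by rewrite normc_real ?invr_ge0//; lra.
apply: (@bounded_difference_not_weakly_hypercyclic _ phi disk0 (in_disk half)) => //.
  by rewrite !pt_in_disk eq_sym fmorph_eq0 invr_eq0 pnatr_eq0.
move=> f; set u := disk0; set v := in_disk half.
(* Non-tangential approach: [|w + 1| / Re w] is bounded along the orbit. *)
pose K z := normc (cayley z + 1) / Re (cayley z) + normc B / Re B.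
have KP z n : normc (cayley (iter n phi z) + 1) <= K z * Re (cayley (iter n phi z)).
  rewrite cayley_iter_translation//.
  have -> : Re (cayley z + B *+ n) = Re (cayley z) + n%:R * Re B.
    by rewrite raddfD raddfMn /= mulr_natl.
  have r0 := Re_cayley_gt0 z.
  apply: le_trans (_ : normc (cayley z + 1) + n%:R * normc B <= _).
    rewrite addrAC; apply: le_trans (normcD _ _) _; rewrite lerD2l.
    rewrite -[B *+ n]mulr_natl normcM; have -> : (n%:R : R[i]) = (n%:R : R)%:C by rewrite rmorph_nat.
    by rewrite normc_real.
  rewrite /K mulrDl !mulrDr divfK ?gt_eqF// -!addrA lerD2l.
  have -> : normc B / Re B * (n%:R * Re B) = n%:R * normc B by field; rewrite gt_eqF.
  rewrite addrA lerDr addr_ge0// !mulr_ge0 ?invr_ge0 ?normc_ge0 ?(ltW r0) ?(ltW ReB)//.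
have inv1 z : (1 - normc (pt z))^-1 <= normc (cayley z + 1) ^+ 2 / (2 * Re (cayley z)).
  have r0 := Re_cayley_gt0 z; have z1 := disk_normc z.
  have n0 : 0 < normc (al - pt z) by rewrite normc_gt0 al_sub_neq0.
  have -> : normc (cayley z + 1) = 2 / normc (al - pt z).
    by rewrite [in RHS]normcBC pt_sub_al invfM invrK mulrA mulfV ?pnatr_eq0// mul1r.
  have e := Re_cayley z.
  have z0 := normc_ge0 (pt z).
  rewrite -[leLHS]mul1r ler_pdivrMr ?subr_gt0//.
  rewrite mulrAC ler_pdivlMr ?mulr_gt0// mul1r expr_div_n mulrAC ler_pdivlMr ?exprn_gt0//.
  rewrite -mulrA e; move: z0 z1; move: (normc (pt z)) => x; nra.
exists (nrm f * (2 * normc (cayley u - cayley v) * K u * K v)) => n.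
apply: le_trans (eval_difference_le f _ _) _; apply: ler_wpM2l; first exact: nrm_ge0.
set un := iter n phi u; set vn := iter n phi v.
have d0 : cayley un - cayley vn = cayley u - cayley v.
  by rewrite /un /vn !cayley_iter_translation// opprD addrACA subrr addr0.
have hu := KP u n; have hv := KP v n; rewrite -/un -/vn in hu hv.
have ru := Re_cayley_gt0 un; have rv := Re_cayley_gt0 vn.
have u1 : 0 < normc (cayley un + 1).
  by rewrite normc_gt0 half_plane_neqN1// ltW.
have v1 : 0 < normc (cayley vn + 1).
  by rewrite normc_gt0 half_plane_neqN1// ltW.
have dist : normc (pt un - pt vn) =
    2 * normc (cayley u - cayley v) / (normc (cayley un + 1) * normc (cayley vn + 1)).
  rewrite -!cayleyK.
  have -> : cayley_inv (cayley un) - cayley_inv (cayley vn) =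
      2 * al * (cayley un - cayley vn) / ((cayley un + 1) * (cayley vn + 1)).
    by rewrite /cayley_inv; field; rewrite -!normc_eq0 !gt_eqF.
  rewrite d0 !normcM normcV normcM al1 mulr1.
  have -> : (2 : R[i]) = (2 : R)%:C by rewrite rmorph_nat.
  by rewrite normc_real.
rewrite invfM dist.
have iu := inv1 un; have iv := inv1 vn.
have := normc_ge0 (cayley u - cayley v).
have du : 0 <= (1 - normc (pt un))^-1 by rewrite invr_ge0 subr_ge0 ltW// disk_normc.
have dv : 0 <= (1 - normc (pt vn))^-1 by rewrite invr_ge0 subr_ge0 ltW// disk_normc.
move: iu iv du dv hu hv u1 v1 ru rv.
move: (normc (cayley un + 1)) (normc (cayley vn + 1)) (Re (cayley un)) (Re (cayley vn)).
move: (1 - normc (pt un))^-1 (1 - normc (pt vn))^-1 (K u) (K v) (normc (cayley u - cayley v)).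
move=> x y Ku Kv D a b ra rb hx hy x0 y0 ha hb a0 b0 ra0 rb0 D0.
have xa : x <= a * (Ku / 2).
  apply: le_trans hx _; rewrite ler_pdivrMr ?mulr_gt0//.
  have -> : a * (Ku / 2) * (2 * ra) = a * (Ku * ra) by field.
  by rewrite expr2 ler_pM2l.
have yb : y <= b * (Kv / 2).
  apply: le_trans hy _; rewrite ler_pdivrMr ?mulr_gt0//.
  have -> : b * (Kv / 2) * (2 * rb) = b * (Kv * rb) by field.
  by rewrite expr2 ler_pM2l.
apply: le_trans (_ : 2 * D / (a * b) * ((a * (Ku / 2)) * (b * (Kv / 2))) <= _).
  apply: ler_wpM2l; first by rewrite divr_ge0 ?mulr_ge0// ltW.
  exact: ler_pM.
have Ku0 : 0 <= Ku by rewrite -(pmulr_lge0 _ ra0) (le_trans (ltW a0) ha).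
have Kv0 : 0 <= Kv by rewrite -(pmulr_lge0 _ rb0) (le_trans (ltW b0) hb).
have -> : 2 * D / (a * b) * ((a * (Ku / 2)) * (b * (Kv / 2))) = D * Ku * Kv / 2.
  by field; rewrite !gt_eqF.
have : 0 <= D * Ku * Kv by rewrite !mulr_ge0.
lra.
Qed.

End half_plane.

Section half_plane_hypercyclic.
Context {R : realType}.

Local Notation C := composition_operator.
Local Notation disk0 := (@disk0 R).

Lemma cvg0_dominated (u v : nat -> R) (K : R) : (forall n, 0 <= u n) ->
  (forall n, u n <= K * v n) -> v @ \oo --> (0 : R) -> u @ \oo --> (0 : R).
Proof.
move=> u0 uv v0; apply: (@squeeze_cvgr _ _ _ _ (fun=> 0) (fun n => K * v n)).
- by apply: nearW => n; rewrite u0 uv.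
- exact: cvg_cst.
- suff : (fun n => K * v n) @ \oo --> K * 0 by rewrite mulr0.
  by apply: cvgM; [exact: cvg_cst|exact: v0].
Qed.

Lemma Re_realM (x : R) (w : R[i]) : Re (x%:C * w) = x * Re w.
Proof. by case: w => u v /=; ring. Qed.

Variable al : R[i].
Hypothesis al1 : normc al = 1.
Variables (phi : disk R -> disk R) (A : R) (B : R[i]).
Hypothesis lphi : linear_fractional phi.
Hypothesis A0 : 0 < A.
Hypothesis hphi : forall z, cayley al (phi z) = A%:C * cayley al z + B.

Lemma half_plane_map (p : nat -> R) (q : nat -> R[i]) :
  (forall n, 0 < p n) -> (forall n, 0 <= Re (q n)) ->
  exists2 chi : nat -> disk R -> disk R, forall n, linear_fractional (chi n) &
    forall n z, cayley al (chi n z) = (p n)%:C * cayley al z + q n.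
Proof.
move=> p0 q0.
have /choice[chi hchi] : forall n, exists chi : disk R -> disk R,
    linear_fractional chi /\ forall z, cayley al (chi z) = (p n)%:C * cayley al z + q n.
  by move=> n; have [chi l e] := half_plane_affine al1 (p0 n) (q0 n); exists chi.
by exists chi => n; have [] := hchi n.
Qed.

(** The point at infinity of the half-plane is [al]. *)
Lemma near_infinity (z : disk R) (M : R) : 0 < M -> M <= normc (cayley al z + 1) ->
  normc (pt z - al) <= 2 * M^-1.
Proof.
move=> M0 h; rewrite (pt_sub_al al1); apply: ler_wpM2l => //.
by rewrite lef_pV2// posrE//; apply: lt_le_trans h.
Qed.

(** [B / (A - 1)] translates the fixed point of [w -> A w + B] to [0]; in the
    translated coordinate [phi] is the dilation by [A], which is invertible on
    the whole half-plane. *)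
Lemma hyperbolic_hypercyclic : A != 1 -> 0 <= Re (B / (A - 1)%:C) ->
  (A < 1 -> Re (B / (A - 1)%:C) = 0) -> hypercyclic (C phi).
Proof.
move=> A1; set s := B / _ => s0 sA.
have Ai0 : 0 < A^-1 by rewrite invr_gt0.
have An0 n : 0 < A ^+ n by rewrite exprn_gt0.
have Ain0 n : 0 < A^-1 ^+ n by rewrite exprn_gt0.
have [psi lpsi hpsi] := half_plane_affine al1 (ltr01) s0.
have hpsi' z : cayley al (psi z) = cayley al z + s by rewrite hpsi rmorph1 mul1r.
have qs n : 0 <= Re ((A^-1 ^+ n)%:C * s) by rewrite Re_realM mulr_ge0// ltW.
have [psin lpsin hpsin] := half_plane_map Ain0 qs.
have inv n : (A^-1 ^+ n)%:C * (A ^+ n)%:C = 1 :> R[i].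
  by rewrite -rmorphM /= -exprMn mulVf ?gt_eqF// expr1n.
have rel n z : psin n (iter n phi z) = psi z.
  apply: (cayley_inj al1); rewrite hpsin hpsi' (cayley_iter_dilation hphi)// -/s.
  by rewrite mulrBr mulrA inv mul1r subrK.
have dr := translation_dense_range al1 s0 hpsi'.
have cphi n : cayley al (iter n phi disk0) = (A ^+ n)%:C * (1 + s) - s.
  by rewrite (cayley_iter_dilation hphi)// cayley_disk0.
have cpsi n : cayley al (psin n disk0) = (A^-1 ^+ n)%:C * (1 + s).
  by rewrite hpsin cayley_disk0// mulrDr.
have RepsiE n : Re (cayley al (psin n disk0)) = A^-1 ^+ n * (1 + Re s).
  by rewrite cpsi Re_realM raddfD.
have [Agt|Alt|Aeq] := ltgtP 1 A; last by rewrite Aeq eqxx in A1.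
- have lim : (fun n => A^-1 ^+ n) @ \oo --> (0 : R).
    by apply: cvg_expr; rewrite ger0_norm ?(ltW Ai0)// invf_lt1.
  apply: (@hypercyclic_of_boundary_limits _ phi psi psin al (cayley_inv al 0)) => //.
  + by rewrite normc_cayley_inv.
  + apply: (cvg0_dominated (K := 2) _ _ lim) => n; first exact: normc_ge0.
    rewrite exprVn; apply: near_infinity => //.
    apply: le_trans (normcD1_ge _).
    rewrite cphi raddfB /= Re_realM raddfD /=.
    have : 0 <= (A ^+ n - 1) * Re s.
      by rewrite mulr_ge0// subr_ge0 exprn_ege1// ltW.
    by lra.
  + apply: (cvg0_dominated (K := 2 * normc (1 + s)) _ _ lim) => n; first exact: normc_ge0.
    have z0 : 0 <= Re (0 : R[i]) by [].
    apply: le_trans (pt_sub_cayley_inv al1 _ z0) _.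
    by rewrite subr0 cpsi normcM normc_real ?(ltW (Ain0 n))// -mulrA [X in _ <= _ * X]mulrC.
- have s00 := sA Alt.
  have lim : (fun n => A ^+ n) @ \oo --> (0 : R).
    by apply: cvg_expr; rewrite ger0_norm ?(ltW A0).
  apply: (@hypercyclic_of_boundary_limits _ phi psi psin (cayley_inv al (- s)) al) => //.
  + by rewrite normc_cayley_inv// raddfN /= s00 oppr0.
  + apply: (cvg0_dominated (K := 2 * normc (1 + s)) _ _ lim) => n; first exact: normc_ge0.
    have ns : 0 <= Re (- s) by rewrite raddfN /= s00 oppr0.
    apply: le_trans (pt_sub_cayley_inv al1 _ ns) _.
    by rewrite opprK cphi subrK normcM normc_real ?(ltW (An0 n))// -mulrA [X in _ <= _ * X]mulrC.
  + apply: (cvg0_dominated (K := 2) _ _ lim) => n; first exact: normc_ge0.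
    have -> : A ^+ n = (A^-1 ^+ n)^-1 by rewrite exprVn invrK.
    apply: near_infinity => //; apply: le_trans (normcD1_ge _).
    by rewrite RepsiE s00 addr0 mulr1 lerDl.
Qed.

(** Both [phi^n] and its inverse, translations by [n B] and [- n B] along the
    imaginary axis, drive the base point to [al]. *)
Lemma parabolic_automorphism_hypercyclic : A = 1 -> Re B = 0 -> B != 0 ->
  hypercyclic (C phi).
Proof.
move=> A1 ReB Bn0.
have y0 : 0 < `|Im B|.
  rewrite normr_gt0; apply: contraNneq Bn0 => ImB.
  by move: ReB ImB; case: (B) => u v /= -> ->.
have ReBn n : Re (B *+ n) = 0 by rewrite raddfMn /= ReB mul0rn.
have qB n : 0 <= Re (- (B *+ n)) by rewrite raddfN /= ReBn oppr0.
have [psin lpsin hpsin] := half_plane_map (fun=> ltr01) qB.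
have rel n z : psin n (iter n phi z) = id z.
  apply: (cayley_inj al1); rewrite hpsin (cayley_iter_translation hphi)//.
  by rewrite rmorph1 mul1r addrK.
pose K : R := 1 + `|Im B|^-1.
have K0 : 0 < K by rewrite addr_gt0 ?invr_gt0.
have far (z : disk R) n (e : R) : `|e| = 1 -> cayley al z = 1 + e%:C * (B *+ n) ->
    normc (pt z - al) <= (2 * K) * n.+1%:R^-1.
  move=> e1 h.
  have -> : (2 * K) * n.+1%:R^-1 = 2 * (n.+1%:R / K)^-1 by rewrite invf_div mulrA.
  apply: near_infinity; first by rewrite divr_gt0 ?ltr0n.
  rewrite ler_pdivrMr// /K mulrDr mulr1 -natr1 addrC; apply: lerD.
    apply: le_trans (normcD1_ge _); rewrite h raddfD /= Re_realM ReBn mulr0.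
    by lra.
  rewrite ler_pdivlMr//; apply: le_trans (normc_Im _).
  rewrite h !raddfD /= addr0 add0r.
  have -> : Im (e%:C * (B *+ n)) = e * (n%:R * Im B).
    by rewrite mulr_natl -raddfMn /=; case: (B *+ n) => u v /=; ring.
  by rewrite !normrM e1 mul1r normr_nat.
have lim : (fun n => n.+1%:R^-1 : R) @ \oo --> (0 : R) by exact: cvg_harmonic.
apply: (@hypercyclic_of_boundary_limits _ phi id psin al al) => //.
- exact: linear_fractional_id.
- apply: (cvg0_dominated (K := 2 * K) _ _ lim) => n; first exact: normc_ge0.
  apply: (far _ _ 1); first exact: normr1.
  by rewrite (cayley_iter_translation hphi)// cayley_disk0// rmorph1 mul1r.
- apply: (cvg0_dominated (K := 2 * K) _ _ lim) => n; first exact: normc_ge0.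
  apply: (far _ _ (-1)); first by rewrite normrN normr1.
  by rewrite hpsin cayley_disk0// rmorphN !rmorph1 mul1r mulN1r.
- move=> f; apply: approximableW; exists f => //; apply: H2_ext => z.
  by rewrite composition_operatorE//; exact: linear_fractional_id.
Qed.

(** [w -> A w + B] with [A > 0] and [0 <= Re B] has a fixed point in the open
    half-plane if [A < 1] and [0 < Re B], or if it is the identity; it is a
    parabolic non-automorphism if [A = 1] and [0 < Re B]. In the other cases the
    operator is hypercyclic. *)
Lemma half_plane_dichotomy : 0 <= Re B ->
  hypercyclic (C phi) \/ ~ weakly_hypercyclic (C phi).
Proof.
move=> B0.
have sE : Re (B / (A - 1)%:C) = Re B / (A - 1).
  by rewrite -fmorphV mulrC Re_realM mulrC.
have [A1|A1] := eqVneq A 1.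
  have [ReB|ReB] := eqVneq (Re B) 0; last first.
    right; apply: (parabolic_nonautomorphism al1 lphi hphi) => //.
    by rewrite lt_neqAle eq_sym ReB.
  have [Bz|Bn0] := eqVneq B 0; last by left; exact: parabolic_automorphism_hypercyclic.
  right; apply: (half_plane_fixed_point al1 lphi hphi (w := 1)) => //=.
  by rewrite A1 Bz rmorph1 mulr1 addr0.
have A1' : (A - 1)%:C != 0 :> R[i] by rewrite fmorph_eq0 subr_eq0.
have [Agt|Alt|Aeq] := ltgtP 1 A; last by rewrite Aeq eqxx in A1.
  left; apply: hyperbolic_hypercyclic => //.
    by rewrite sE divr_ge0// subr_ge0 ltW.
  by move=> lt; have := lt_trans lt Agt; rewrite ltxx.
have [ReB|ReB] := eqVneq (Re B) 0.
  by left; apply: hyperbolic_hypercyclic; rewrite // sE ReB mul0r.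
right; apply: (half_plane_fixed_point al1 lphi hphi (w := - (B / (A - 1)%:C))).
  rewrite raddfN /= sE -mulrN -invrN opprB divr_gt0 ?subr_gt0//.
  by rewrite lt_neqAle eq_sym ReB.
by rewrite rmorphB rmorph1 in A1' *; field.
Qed.

End half_plane_hypercyclic.

(** * Fixed points of linear fractional self-maps *)

Section fixed_points.
Context {R : realType}.

Local Notation C := composition_operator.
Local Notation disk0 := (@disk0 R).

(** Turns a bound for [|k z + t|] over the disk into one for [|k| + |t|]. *)
Lemma aligned_direction (k t : R[i]) : exists2 u, normc u = 1 &
  forall r : R, 0 <= r -> normc (k * (r%:C * u) + t) = r * normc k + normc t.
Proof.
have [->|k0] := eqVneq k 0.
  by exists 1; rewrite ?normc1// => r r0; rewrite mul0r add0r normc0 mulr0 add0r.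
have [->|t0] := eqVneq t 0.
  exists 1; rewrite ?normc1// => r r0.
  by rewrite mulr1 addr0 normc0 addr0 normcM normc_real// mulrC.
have nk : normc k != 0 by rewrite normc_eq0.
have nt : normc t != 0 by rewrite normc_eq0.
have nt' : (normc t)%:C != 0 :> R[i] by rewrite fmorph_eq0.
exists ((normc k)%:C / k * (t / (normc t)%:C)).
  by rewrite !normcM !normcV !normc_real ?normc_ge0// mulfV// mul1r mulfV.
move=> r r0.
have -> : k * (r%:C * ((normc k)%:C / k * (t / (normc t)%:C))) + t =
    (r * normc k + normc t)%:C * (t / (normc t)%:C).
  by rewrite rmorphD rmorphM /=; field; rewrite k0 nt'.
rewrite normcM normc_real ?addr_ge0 ?mulr_ge0 ?normc_ge0//.
by rewrite normcM normcV normc_real ?normc_ge0// mulfV// mulr1.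
Qed.

(** An affine map of the closed disk moves the centre by at most [1 - |k|],
    and the fixed point is the displacement divided by [1 - k]. *)
Lemma affine_fixed_point (k t : R[i]) :
  (forall z : disk R, normc (k * pt z + t) <= 1) ->
  exists2 x : R[i], normc x <= 1 & k * x + t = x.
Proof.
move=> h.
have kt : normc k + normc t <= 1.
  have [u u1 e] := aligned_direction k t.
  suff : 0 <= (1 - normc t) + - normc k + 0 by lra.
  apply: quadratic_ge0_at1 => r r0 r1.
  have ru : normc (r%:C * u) < 1 by rewrite normcM u1 mulr1 normc_real ?ltW.
  by have := h (in_disk ru); rewrite pt_in_disk e ?(ltW r0)//; lra.
have [k1|k1] := eqVneq k 1.
  have t0 : t = 0.
    apply/eqP; rewrite -normc_eq0 eq_le normc_ge0 andbT.
    by move: kt; rewrite k1 normc1; lra.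
  by exists 0; rewrite ?normc0// t0 mulr0 addr0.
have k1' : 1 - k != 0 by rewrite subr_eq0 eq_sym.
exists (t / (1 - k)); last by field.
rewrite normcM normcV ler_pdivrMr ?normc_gt0// mul1r.
by have := normcB_ge 1 k; rewrite normc1; lra.
Qed.

Lemma reflection_energy (q x : R[i]) :
  normc (q - x) ^+ 2 - normc (1 - conjc q * x) ^+ 2 =
  (normc q ^+ 2 - 1) * (1 - normc x ^+ 2).
Proof. by rewrite !sqr_normcE; case: q x => [q q'] [x x'] /=; ring. Qed.

Lemma normc_conjc (q : R[i]) : normc (conjc q) = normc q.
Proof.
apply/eqP; rewrite -(@eqrXn2 _ 2) ?normc_ge0// !sqr_normcE.
by case: q => u v /=; rewrite sqrrN.
Qed.

(** A fixed point [q] outside the closed disk is moved to infinity by the disk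
    automorphism [(1 - q^* z) / (q - z)], which makes the map affine. *)
Lemma fixed_point_in_closed_disk (phi : disk R -> disk R) (a b c d : R[i]) :
  a * d - b * c != 0 -> (forall z, c * pt z + d != 0) ->
  (forall z, pt (phi z) = (a * pt z + b) / (c * pt z + d)) ->
  exists2 x, normc x <= 1 & a * x + b = x * (c * x + d).
Proof.
move=> det nopole hphi.
have [c0|c0] := eqVneq c 0.
  have d0 : d != 0 by have := nopole disk0; rewrite c0 mul0r add0r.
  have [z|x x1 ex] := @affine_fixed_point (a / d) (b / d).
    have -> : a / d * pt z + b / d = pt (phi z) by rewrite hphi c0 mul0r add0r; field.
    by rewrite ltW// disk_normc.
  exists x => //; rewrite c0 mul0r add0r -{2}ex; field.
  exact: d0.
have [q eq] : exists q, a * q + b = q * (c * q + d).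
  pose D := (d - a) ^+ 2 + 4 * (b * c).
  exists ((a - d + sqrtc D) / (2 * c)).
  have eD : sqrtc D ^+ 2 = (d - a) ^+ 2 + 4 * (b * c) by rewrite sqr_sqrtc.
  apply/eqP; rewrite -subr_eq0; apply/eqP.
  have -> : a * ((a - d + sqrtc D) / (2 * c)) + b -
      (a - d + sqrtc D) / (2 * c) * (c * ((a - d + sqrtc D) / (2 * c)) + d) =
      ((d - a) ^+ 2 + 4 * (b * c) - sqrtc D ^+ 2) / (4 * c) by field.
  by rewrite eD subrr mul0r.
have [q1|q1] := leP (normc q) 1; first by exists q.
have q2 : 0 < normc q ^+ 2 - 1 by rewrite subr_gt0 -(expr1n _ 2) ltr_sqr ?nnegrE ?normc_ge0.
have m0 : a - q * c != 0.
  apply: contraNneq det => /eqP; rewrite subr_eq0 => /eqP e.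
  have -> : b = q * d.
    apply/eqP; rewrite -subr_eq0; apply/eqP.
    by rewrite (_ : b - q * d = a * q + b - q * (a + d)) ?[in RHS]e ?eq ?e; ring.
  by rewrite e; apply/eqP; ring.
(* [k] and [t] are the coefficients of the map in the coordinate that sends [q]
   to infinity. *)
pose E : R[i] := 1 - q * conjc q.
have EE : E = (1 - normc q ^+ 2)%:C.
  by rewrite /E sqr_normcE; case: (q) => u v; apply/eqP; rewrite eq_complex /=; apply/andP; split; apply/eqP; ring.
have E0 : E != 0 by rewrite EE fmorph_eq0 -oppr_eq0 opprB gt_eqF.
have qz (x : R[i]) : normc x <= 1 -> q - x != 0.
  move=> x1; rewrite subr_eq0; apply: contraTneq x1 => <-.
  by rewrite -ltNge.
have qz' (x : R[i]) : normc x <= 1 -> conjc q - x != 0.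
  move=> x1; rewrite subr_eq0; apply: contraTneq x1 => <-.
  by rewrite normc_conjc -ltNge.
pose k := (c * q + d) / (a - q * c).
pose t := conjc q * (1 - k) - E * (c / (a - q * c)).
have conj_phi (z : disk R) : k * ((1 - conjc q * pt z) / (q - pt z)) + t =
    (1 - conjc q * pt (phi z)) / (q - pt (phi z)).
  have n1 := qz _ (ltW (disk_normc z)); have n2 := nopole z.
  have -> : q - pt (phi z) = (a - q * c) * (q - pt z) / (c * pt z + d).
    rewrite hphi; apply/eqP; rewrite -subr_eq0; apply/eqP.
    have -> : q - (a * pt z + b) / (c * pt z + d) - (a - q * c) * (q - pt z) / (c * pt z + d)
      = (q * (c * q + d) - (a * q + b)) / (c * pt z + d) by field.
    by rewrite eq subrr mul0r.
  have eb : b = q * (c * q + d) - a * q by rewrite -eq; ring.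
  by rewrite hphi /t /k /E eb; field; rewrite n1 n2 m0.
have refl (y : R[i]) : normc y <= 1 ->
    normc (1 - q * y) ^+ 2 = normc (conjc q - y) ^+ 2 -
      (normc q ^+ 2 - 1) * (1 - normc y ^+ 2).
  move=> y1; have := reflection_energy (conjc q) y; rewrite normc_conjc.
  have -> : conjc (conjc q) = q by case: (q) => u v /=; rewrite opprK.
  by move=> <-; ring.
have [y|x x1 ex] := @affine_fixed_point k t.
  have y1 := disk_normc y; have ny := qz' _ (ltW y1).
  have hz : normc ((1 - q * pt y) / (conjc q - pt y)) < 1.
    rewrite normcM normcV ltr_pdivrMr ?normc_gt0// mul1r.
    rewrite -ltr_sqr ?nnegrE ?normc_ge0// refl ?(ltW y1)// gtrBl mulr_gt0//.
    by rewrite subr_gt0 -(expr1n _ 2) ltr_sqr ?nnegrE ?normc_ge0.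
  have := conj_phi (in_disk hz); rewrite pt_in_disk.
  have -> : (1 - conjc q * ((1 - q * pt y) / (conjc q - pt y))) /
      (q - (1 - q * pt y) / (conjc q - pt y)) = pt y.
    field; rewrite ny /= (_ : _ - _ = - E) ?oppr_eq0//.
    by rewrite /E; ring.
  move=> ->; have p1 := disk_normc (phi (in_disk hz)).
  rewrite normcM normcV ler_pdivrMr ?normc_gt0 ?qz ?(ltW p1)// mul1r.
  rewrite -ler_sqr ?nnegrE ?normc_ge0// -subr_ge0 reflection_energy mulr_ge0 ?(ltW q2)//.
  by rewrite subr_ge0 expr_le1 ?normc_ge0// ltW.
have nx := qz' _ x1.
set z := (1 - q * x) / (conjc q - x).
have cz : c * z = a - d - q * c.
  have : (a - 2 * (q * c) - d) * (x - conjc q) + E * c = (a - q * c) * (x - (k * x + t)).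
    by rewrite /t /k; field.
  rewrite ex subrr mulr0 => H; apply/eqP; rewrite -subr_eq0; apply/eqP.
  have -> : c * z - (a - d - q * c) =
      ((a - 2 * (q * c) - d) * (x - conjc q) + E * c) / (conjc q - x).
    by rewrite /z /E; field.
  by rewrite H mul0r.
exists z; first last.
  rewrite cz; apply/eqP; rewrite -subr_eq0; apply/eqP.
  have -> : a * z + b - z * (a - d - q * c + d) = b + q * (c * z) by ring.
  rewrite cz; have -> : b + q * (a - d - q * c) = (a * q + b) - q * (c * q + d) by ring.
  by rewrite eq subrr.
rewrite normcM normcV ler_pdivrMr ?normc_gt0// mul1r.
rewrite -ler_sqr ?nnegrE ?normc_ge0// refl// gerBl mulr_ge0 ?(ltW q2)//.
by rewrite subr_ge0 -(expr1n _ 2) ler_sqr ?nnegrE ?normc_ge0.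
Qed.

(** In the half-plane whose infinity is a boundary fixed point, the map is
    affine; preserving the half-plane makes it a real dilation followed by a
    translation to the right. *)
Lemma boundary_fixed_point_affine (phi : disk R -> disk R) (a b c d al : R[i]) :
  a * d - b * c != 0 -> normc c < normc d ->
  (forall z, c * pt z + d != 0) ->
  (forall z, pt (phi z) = (a * pt z + b) / (c * pt z + d)) ->
  normc al = 1 -> a * al + b = al * (c * al + d) ->
  exists (A : R) (B : R[i]), [/\ 0 < A, 0 <= Re B &
    forall z, cayley al (phi z) = A%:C * cayley al z + B].
Proof.
move=> det cd nopole hphi al1 fal.
have al0 : al != 0 by rewrite -normc_eq0 al1 oner_eq0.
have m0 : a - al * c != 0.
  apply: contraNneq det => /eqP; rewrite subr_eq0 => /eqP e.
  have -> : b = al * d.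
    apply/eqP; rewrite -subr_eq0; apply/eqP.
    by rewrite (_ : b - al * d = a * al + b - al * (a + d)) ?[in RHS]e ?fal ?e; ring.
  by rewrite e; apply/eqP; ring.
pose A0 := (c * al + d) / (a - al * c).
pose B0 := A0 - (a + al * c) / (a - al * c).
have aff z : cayley al (phi z) = A0 * cayley al z + B0.
  have n1 := al_sub_neq0 al1 z; have n2 := nopole z.
  have eb : b = al * (c * al + d) - a * al by rewrite -fal; ring.
  rewrite /cayley.
  have -> : al - pt (phi z) = (a - al * c) * (al - pt z) / (c * pt z + d).
    by rewrite hphi eb; field.
  by rewrite hphi /B0 /A0 eb; field; rewrite m0 n1 n2.
have pos w : 0 < Re w -> 0 < Re (A0 * w + B0).
  by move=> /(disk_of_half_plane al1)[z <-]; rewrite -aff Re_cayley_gt0.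
have A0n0 : A0 != 0.
  rewrite mulf_neq0 ?invr_eq0//; apply: contraTneq cd => /eqP.
  rewrite addr_eq0 => /eqP e.
  by rewrite -leNgt -[normc d]normcN -e normcM al1 mulr1.
clearbody A0 B0; move: A0 B0 aff pos A0n0 => [p p'] [u u'] aff pos A0n0.
have p'0 : p' = 0.
  apply/eqP; apply: contraT => p'0.
  have e0 : p * 1 - p' * ((p + u) / p') + u = 0 by field.
  by have := pos (1 +i* ((p + u) / p')) ltr01; rewrite /= e0 ltxx.
have lin (s : R) : 0 < s -> 0 < p * s + u.
  by move=> s0; have := pos (s +i* 0) s0; rewrite /= mulr0 subr0.
have p0 : 0 <= p.
  rewrite leNgt; apply/negP => pneg.
  have s0 : 0 < (`|u| + 1) / - p by rewrite divr_gt0 ?oppr_gt0// ltr_wpDl.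
  have := lin _ s0; rewrite (_ : p * _ = - (`|u| + 1)); last by field; rewrite lt_eqF.
  by have := ler_norm u; lra.
have u0 : 0 <= u.
  rewrite leNgt; apply/negP => uneg.
  have p10 : 0 < p + 1 by lra.
  have s0 : 0 < - u / (p + 1) by rewrite divr_gt0 ?oppr_gt0.
  have := lin _ s0; rewrite (_ : _ + u = u / (p + 1)); last by field; rewrite gt_eqF.
  by rewrite pmulr_lgt0 ?invr_gt0// ltNge ltW.
exists p, (u +i* u'); split => //; last by move=> z; rewrite aff p'0.
rewrite lt_neqAle p0 andbT eq_sym; apply: contra_neq A0n0 => ->.
by rewrite p'0.
Qed.

Lemma composition_dichotomy (phi : disk R -> disk R) : linear_fractional phi ->
  hypercyclic (C phi) \/ ~ weakly_hypercyclic (C phi).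
Proof.
move=> lphi; have [a [b [c [d [det nopole hphi]]]]] := linear_fractionalP lphi.
have selfmap z : normc (a * pt z + b) <= normc (c * pt z + d).
  have := disk_normc (phi z).
  by rewrite hphi normcM normcV ltr_pdivrMr ?normc_gt0// mul1r => /ltW.
have [x x1 ex] := fixed_point_in_closed_disk det nopole hphi.
move: x1; rewrite le_eqVlt => /predU1P[x1|x1]; last first.
  right; apply: (fixed_point_not_weakly_hypercyclic (p := in_disk x1)) => //.
  have np := nopole (in_disk x1); rewrite pt_in_disk in np.
  by apply: pt_inj; rewrite hphi pt_in_disk ex mulfK.
have [A [B [A0 B0 aff]]] :=
  boundary_fixed_point_affine det (pole_outside nopole selfmap det) nopole hphi x1 ex.
exact: (half_plane_dichotomy x1 lphi A0 aff B0).
Qed.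

End fixed_points.

Theorem theorem4p2 (R : realType) (phi : disk R -> disk R)
    (hphi : linear_fractional phi) :
  hypercyclic (composition_operator phi) <->
  weakly_hypercyclic (composition_operator phi).
Proof.
split; first exact: hypercyclic_weakly_hypercyclic.
by case: (composition_dichotomy hphi).
Qed.
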